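(* Let $R$ be a regular ring (in the sense of Vogel) and $S$ an $R$-bimodule, flat on the left. Let $n\ge 0$ and let $C_*$ be a reduced $\mathcal{D}_0$-complex in $\tilde{\mathcal{B}}$. Then $C_*$ is $\mathcal{B}_n$-local if and only if $C_i$ is contractible for all $0\le i\le n$.
   Context: A ring $R$ is regular in the sense of Vogel if the smallest class of right $R$-modules containing the finitely generated projective modules, closed under filtered colimits and satisfying the 2/3 property for short exact sequences, is the class of all right $R$-modules. Complexes are $\mathbb{Z}$-graded with differential of degree $-1$, and are complexes of projective right $R$-modules. A complex is finite if the direct sum of its terms is finitely generated; it is h-finite if it is chain homotopy equivalent to a finite complex. A $\mathcal{D}_0$-complex $C_*$ consists of complexes $C_i$ of projective right $R$-modules ($i\in\mathbb{N}$) with chain maps $\lambda_i:C_i\to C_{i+1}$ and $\alpha_{i+1}:C_{i+1}\to C_i\otimes_R S$ satisfying $\alpha\circ\lambda=\lambda\circ\alpha$, i.e. $\alpha_{i+1}\lambda_i=(\lambda_{i-1}\otimes S)\alpha_i:C_i\to C_i\otimes_R S$. Acyclicity, exactness and homology equivalences are understood for each index $i$. For $n\ge0$, $\mathcal{B}_n$ is the class of $\mathcal{D}_0$-complexes $B_*$ with $B_0=0$, each $B_i$ h-finite, each $\lambda_i$ a cofibration, and $\lambda_i$ a weak (homology) equivalence for all $i\ge n$. $\mathcal{B}=\varinjlim\mathcal{B}_n$ is the union along the inclusions $\mathcal{B}_n\subset\mathcal{B}_{n+1}$. A $\mathcal{D}_0$-complex is reduced if all maps $\alpha_i$ are surjective.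 A class of $\mathcal{D}_0$-complexes is exact if it contains all finite acyclic $\mathcal{D}_0$-complexes and satisfies the 2/3 axiom for short exact sequences. $\tilde{\mathcal{B}}$ is the completion of $\mathcal{B}$: the smallest exact class containing $\mathcal{B}$ and stable under arbitrary direct sums. A $\mathcal{D}_0$-complex $X$ is $\mathcal{B}_n$-local if every morphism of $\mathcal{D}_0$-complexes $Y\to X$ with $Y\in\mathcal{B}_n$ factorizes through an acyclic $\mathcal{D}_0$-complex. *)

(* Defs.v *)
From HB Require Import structures.
From mathcomp Require Import all_boot all_order all_algebra.
From mathcomp Require Import boolp.

Set Implicit Arguments.
Unset Strict Implicit.
Unset Printing Implicit Defensive.

Import GRing.Theory.
Local Open Scope ring_scope.
Local Open Scope quotient_scope.

(* Right R-modules are left modules over the converse ring R^c: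
   r *: m stands for m.r *)
Notation rmodType R := (lmodType R^c).

Record bimodule (R : pzRingType) := Bimodule {
  bimod_sort :> rmodType R;
  lact : R -> bimod_sort -> bimod_sort;
  lact_addr : forall r s t, lact r (s + t) = lact r s + lact r t;
  lact_addl : forall r q s, lact (r + q) s = lact r s + lact q s;
  lact_mul : forall r q s, lact (r * q) s = lact r (lact q s);
  lact_one : forall s, lact 1 s = s;
  lact_scale : forall r (q : R^c) s, lact r (q *: s) = q *: lact r s }.

Definition surj (A B : Type) (f : A -> B) : Prop := forall y, exists x, f x = y.

Definition two_of_three (P Q T : Prop) : Prop :=
  [/\ P -> Q -> T, P -> T -> Q & Q -> T -> P].

Section Modules.
Variable R : pzRingType.

Definition projective (P : rmodType R) : Prop :=
  forall (M N : rmodType R) (p : {linear M -> N}) (f : {linear P -> N}),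
    surj p -> exists g : {linear P -> M}, forall x, p (g x) = f x.

Definition fin_gen (M : rmodType R) : Prop :=
  exists (n : nat) (e : 'I_n -> M), forall m,
    exists c : 'I_n -> R^c, m = \sum_i c i *: e i.

Definition mod_exact (A B C : rmodType R)
    (f : {linear A -> B}) (g : {linear B -> C}) : Prop :=
  [/\ injective f, forall y, g y = 0 <-> exists x, f x = y & surj g].

Definition is_direct_sum (T : Type) (F : T -> rmodType R) (D : rmodType R)
    (inj : forall t, {linear F t -> D}) : Prop :=
  forall (N : rmodType R) (g : forall t, {linear F t -> N}),
  exists h : {linear D -> N},
    (forall t x, h (inj t x) = g t x) /\
    (forall h' : {linear D -> N},
       (forall t x, h' (inj t x) = g t x) -> forall y, h' y = h y).

End Modules.

Record filtered_category := FilteredCategory {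
  fobj :> Type;
  fhom : fobj -> fobj -> Type;
  fid : forall i, fhom i i;
  fcomp : forall i j k, fhom i j -> fhom j k -> fhom i k;
  fcomp_idl : forall i j (u : fhom i j), fcomp (fid i) u = u;
  fcomp_idr : forall i j (u : fhom i j), fcomp u (fid j) = u;
  fcompA : forall i j k l (u : fhom i j) (v : fhom j k) (w : fhom k l),
    fcomp u (fcomp v w) = fcomp (fcomp u v) w;
  f_nonempty : exists i : fobj, True;
  f_upper : forall i j, exists (k : fobj) (u : fhom i k) (v : fhom j k), True;
  f_coequal : forall i j (u v : fhom i j),
    exists (k : fobj) (w : fhom j k), fcomp u w = fcomp v w }.

Section Regularity.
Variable R : pzRingType.

Record diagram (I : filtered_category) := Diagram {
  dobj :> I -> rmodType R;
  dmap : forall i j, fhom i j -> {linear dobj i -> dobj j};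
  dmap_id : forall i x, dmap (fid i) x = x;
  dmap_comp : forall i j k (u : fhom i j) (v : fhom j k) x,
    dmap (fcomp u v) x = dmap v (dmap u x) }.

Definition cocone (I : filtered_category) (F : diagram I) (X : rmodType R)
    (c : forall i, {linear F i -> X}) : Prop :=
  forall i j (u : fhom i j) x, c j (dmap F u x) = c i x.

Definition is_colimit (I : filtered_category) (F : diagram I) (X : rmodType R)
    (c : forall i, {linear F i -> X}) : Prop :=
  cocone c /\
  forall (Y : rmodType R) (g : forall i, {linear F i -> Y}), cocone g ->
  exists h : {linear X -> Y},
    (forall i x, h (c i x) = g i x) /\
    (forall h' : {linear X -> Y},
       (forall i x, h' (c i x) = g i x) -> forall y, h' y = h y).

Definition vogel_closed (P : rmodType R -> Prop) : Prop :=
  [/\ forall M, fin_gen M -> projective M -> P M,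
      forall (I : filtered_category) (F : diagram I) (X : rmodType R)
             (c : forall i, {linear F i -> X}),
        is_colimit c -> (forall i, P (F i)) -> P X
    & forall (A B C : rmodType R) (f : {linear A -> B}) (g : {linear B -> C}),
        mod_exact f g -> two_of_three (P A) (P B) (P C)].

Definition vogel_regular : Prop :=
  forall P : rmodType R -> Prop, vogel_closed P -> forall M, P M.

End Regularity.

(* M (x)_R S is the set of formal sums of pairs (m, s) modulo the congruence
   generated by the usual relations; -(m, s) is represented by (-m, s). *)
Section Tensor.
Variables (R : pzRingType) (S : bimodule R) (M : rmodType R).
Implicit Types (k l : seq (M * S)) (m : M) (s : S).

Inductive tens_rel : seq (M * S) -> seq (M * S) -> Prop :=
| tens_refl l : tens_rel l l
| tens_sym k l : tens_rel k l -> tens_rel l k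
| tens_trans j k l : tens_rel j k -> tens_rel k l -> tens_rel j l
| tens_cat k k' l l' :
    tens_rel k k' -> tens_rel l l' -> tens_rel (k ++ l) (k' ++ l')
| tens_catC k l : tens_rel (k ++ l) (l ++ k)
| tens_0l s : tens_rel [:: (0, s)] [::]
| tens_Dl m m' s : tens_rel [:: (m + m', s)] [:: (m, s); (m', s)]
| tens_Dr m s s' : tens_rel [:: (m, s + s')] [:: (m, s); (m, s')]
| tens_bal m (r : R) s :
    tens_rel [:: ((r : R^c) *: m, s)] [:: (m, lact r s)].

Definition tens_eqb : rel (seq (M * S)) := fun k l => `[< tens_rel k l >].

Lemma tens_eqb_refl : reflexive tens_eqb.
Proof. by move=> l; apply/asboolP; exact: tens_refl. Qed.

Lemma tens_eqb_sym : symmetric tens_eqb.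
Proof. by move=> k l; apply/asboolP/asboolP => /tens_sym. Qed.

Lemma tens_eqb_trans : transitive tens_eqb.
Proof.
by move=> l k j /asboolP kl /asboolP lj; apply/asboolP; apply: tens_trans kl lj.
Qed.

Canonical tens_equiv :=
  EquivRel tens_eqb tens_eqb_refl tens_eqb_sym tens_eqb_trans.

Definition tensor : Type := {eq_quot tens_equiv}.
HB.instance Definition _ := Choice.on tensor.
HB.instance Definition _ := EqQuotient.on tensor.

Definition tclass l : tensor := \pi_tensor l.

Lemma tclassP k l : tens_rel k l <-> tclass k = tclass l.
Proof.
split=> [kl|/eqP]; first by apply/eqP; rewrite piE; apply/asboolP.
by rewrite piE => /asboolP.
Qed.

Lemma tclass_repr (x : tensor) : tclass (repr x) = x.
Proof. exact: reprK. Qed.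

Lemma tensW (P : tensor -> Prop) : (forall l, P (tclass l)) -> forall x, P x.
Proof. by move=> Pl x; rewrite -(tclass_repr x). Qed.

Lemma tens_0r m : tens_rel [:: (m, 0)] [::].
Proof.
have l0 : lact (0 : R) (0 : S) = 0.
  by apply: (addrI (lact 0 0)); rewrite -lact_addr !addr0.
apply: tens_trans (tens_0l 0); rewrite -[in (m, 0)]l0.
by apply: tens_sym; rewrite -(scale0r m); exact: tens_bal.
Qed.

Definition tadd (x y : tensor) := tclass (repr x ++ repr y).
Definition topp (x : tensor) := tclass [seq (- p.1, p.2) | p <- repr x].
Definition tscale (r : R^c) (x : tensor) :=
  tclass [seq (p.1, r *: p.2) | p <- repr x].

Lemma tens_repr l : tens_rel (repr (tclass l)) l.
Proof. by apply/tclassP; rewrite tclass_repr. Qed.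

Lemma taddE k l : tadd (tclass k) (tclass l) = tclass (k ++ l).
Proof. by apply/tclassP/tens_cat; exact: tens_repr. Qed.

Lemma tens_opp k l : tens_rel k l ->
  tens_rel [seq (- p.1, p.2) | p <- k] [seq (- p.1, p.2) | p <- l].
Proof.
elim=> {k l} /=.
- by move=> l; exact: tens_refl.
- by move=> k l _; exact: tens_sym.
- by move=> j k l _ jk _; exact: tens_trans.
- by move=> k k' l l' _ kk' _ ll'; rewrite !map_cat; exact: tens_cat.
- by move=> k l; rewrite !map_cat; exact: tens_catC.
- by move=> s; rewrite oppr0; exact: tens_0l.
- by move=> m m' s; rewrite opprD; exact: tens_Dl.
- by move=> m s s'; exact: tens_Dr.
- by move=> m r s; rewrite -scalerN; exact: tens_bal.
Qed.

Lemma toppE l : topp (tclass l) = tclass [seq (- p.1, p.2) | p <- l].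
Proof. by apply/tclassP/tens_opp; exact: tens_repr. Qed.

Lemma tens_scale (r : R^c) k l : tens_rel k l ->
  tens_rel [seq (p.1, r *: p.2) | p <- k] [seq (p.1, r *: p.2) | p <- l].
Proof.
elim=> {k l} /=.
- by move=> l; exact: tens_refl.
- by move=> k l _; exact: tens_sym.
- by move=> j k l _ jk _; exact: tens_trans.
- by move=> k k' l l' _ kk' _ ll'; rewrite !map_cat; exact: tens_cat.
- by move=> k l; rewrite !map_cat; exact: tens_catC.
- by move=> s; exact: tens_0l.
- by move=> m m' s; exact: tens_Dl.
- by move=> m s s'; rewrite scalerDr; exact: tens_Dr.
- by move=> m q s; rewrite -lact_scale; exact: tens_bal.
Qed.

Lemma tscaleE r l : tscale r (tclass l) = tclass [seq (p.1, r *: p.2) | p <- l].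
Proof. by apply/tclassP/tens_scale; exact: tens_repr. Qed.

Lemma taddA : associative tadd.
Proof.
by elim/tensW=> j; elim/tensW=> k; elim/tensW=> l; rewrite !taddE catA.
Qed.

Lemma taddC : commutative tadd.
Proof.
by elim/tensW=> k; elim/tensW=> l; rewrite !taddE; apply/tclassP/tens_catC.
Qed.

Lemma tadd0 : left_id (tclass [::]) tadd.
Proof. by elim/tensW=> l; rewrite taddE. Qed.

Lemma taddN : left_inverse (tclass [::]) topp tadd.
Proof.
elim/tensW=> l; rewrite toppE taddE; apply/tclassP.
elim: l => [|[m s] l IHl] /=; first exact: tens_refl.
set k := [seq _ | _ <- _] in IHl *.
have ms : tens_rel [:: (- m, s); (m, s)] [::].
  by apply: tens_trans (tens_0l s); rewrite -(addNr m); apply/tens_sym/tens_Dl.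
change (tens_rel (([:: (- m, s)] ++ k) ++ (m, s) :: l) [::]).
apply: tens_trans (tens_cat (tens_catC _ _) (tens_refl _)) _.
rewrite -catA.
exact: tens_trans (tens_cat (tens_refl k) (tens_cat ms (tens_refl l))) IHl.
Qed.

HB.instance Definition _ :=
  GRing.isZmodule.Build tensor taddA taddC tadd0 taddN.

Lemma tclass_cat k l : tclass (k ++ l) = tclass k + tclass l.
Proof. by rewrite -taddE. Qed.

Lemma tscaleA (a b : R^c) x : tscale a (tscale b x) = tscale (a * b) x.
Proof.
elim/tensW: x => l; rewrite !tscaleE -map_comp; congr tclass.
by apply: eq_map => p /=; rewrite scalerA.
Qed.

Lemma tscale1 : left_id 1 tscale.
Proof.
elim/tensW=> l; rewrite tscaleE; congr tclass.
by rewrite -[RHS]map_id; apply: eq_map => -[m s] /=; rewrite scale1r.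
Qed.

Lemma tscaleDr : right_distributive tscale +%R.
Proof.
move=> r; elim/tensW=> k; elim/tensW=> l.
by rewrite -tclass_cat !tscaleE map_cat tclass_cat.
Qed.

Lemma tscaleDl x : {morph tscale^~ x : a b / a + b}.
Proof.
elim/tensW: x => l a b; rewrite !tscaleE.
elim: l => [|[m s] l IHl] /=; first by rewrite -tclass_cat.
have tcons p k : tclass (p :: k) = tclass [:: p] + tclass k.
  by rewrite -tclass_cat.
rewrite tcons IHl (tcons _ [seq (_, a *: _) | _ <- _]).
rewrite (tcons _ [seq (_, b *: _) | _ <- _]) addrACA; congr (_ + _).
by rewrite -tclass_cat scalerDl; apply/tclassP/tens_Dr.
Qed.

HB.instance Definition _ :=
  GRing.Zmodule_isLmodule.Build R^c tensor tscaleA tscale1 tscaleDr tscaleDl.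

End Tensor.

Arguments tclass {R} S {M} l.

Section TensorMap.
Variables (R : pzRingType) (S : bimodule R) (M N : rmodType R).
Variable f : {linear M -> N}.

Definition tmap_seq (l : seq (M * S)) : seq (N * S) :=
  [seq (f p.1, p.2) | p <- l].

(* f (x) S *)
Definition tmap (x : tensor S M) : tensor S N := tclass S (tmap_seq (repr x)).

Lemma tens_tmap k l : tens_rel k l -> tens_rel (tmap_seq k) (tmap_seq l).
Proof.
elim=> {k l} /=.
- by move=> l; exact: tens_refl.
- by move=> k l _; exact: tens_sym.
- by move=> j k l _ jk _; exact: tens_trans.
- by move=> k k' l l' _ kk' _ ll'; rewrite /tmap_seq !map_cat; exact: tens_cat.
- by move=> k l; rewrite /tmap_seq !map_cat; exact: tens_catC.
- by move=> s; rewrite linear0; exact: tens_0l.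
- by move=> m m' s; rewrite linearD; exact: tens_Dl.
- by move=> m s s'; exact: tens_Dr.
- by move=> m r s; rewrite linearZ; exact: tens_bal.
Qed.

Lemma tmapE l : tmap (tclass S l) = tclass S (tmap_seq l).
Proof. by apply/tclassP/tens_tmap; exact: tens_repr. Qed.

Lemma tmap_linear : linear tmap.
Proof.
move=> r; elim/tensW=> k; elim/tensW=> l.
rewrite [r *: _]tscaleE -tclass_cat !tmapE [r *: _]tscaleE -tclass_cat.
by rewrite /tmap_seq map_cat -!map_comp.
Qed.

HB.instance Definition _ :=
  GRing.isLinear.Build R^c (tensor S M) (tensor S N) _ tmap tmap_linear.

End TensorMap.

Arguments tmap {R} S {M N} f x.

Definition left_flat (R : pzRingType) (S : bimodule R) : Prop :=
  forall (M N : rmodType R) (f : {linear M -> N}),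
    injective f -> injective (tmap S f).

Section Complexes.
Variable R : pzRingType.

(* Conditions at a degree where the differential both starts and ends are stated
   at degree k + 1; k ranges over int, so that every degree is covered. *)
Record complex := Complex {
  cobj :> int -> rmodType R;
  diff : forall k : int, {linear cobj (k + 1) -> cobj k};
  diff_diff : forall (k : int) x, diff k (diff (k + 1) x) = 0 }.

Record chain_map (A B : complex) := ChainMap {
  cmap :> forall k : int, {linear A k -> B k};
  cmap_diff : forall (k : int) x, cmap k (diff A k x) = diff B k (cmap (k + 1) x) }.

Definition projective_complex (A : complex) : Prop := forall k, projective (A k).

Definition zero_complex (A : complex) : Prop := forall (k : int) (x : A k), x = 0.

Definition homotopic (A B : complex) (f g : forall k : int, A k -> B k) : Prop :=
  exists h : forall k : int, {linear A k -> B (k + 1)},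
    forall (k : int) x,
      f (k + 1) x - g (k + 1) x =
      diff B (k + 1) (h (k + 1) x) + h k (diff A k x).

Definition contractible (A : complex) : Prop :=
  homotopic (fun (k : int) (x : A k) => x) (fun (k : int) (_ : A k) => 0).

Definition homotopy_equivalent (A B : complex) : Prop :=
  exists (f : chain_map A B) (g : chain_map B A),
    homotopic (fun (k : int) x => g k (f k x)) (fun (k : int) x => x) /\
    homotopic (fun (k : int) x => f k (g k x)) (fun (k : int) x => x).

Definition acyclic (A : complex) : Prop :=
  forall (k : int) (x : A (k + 1)), diff A k x = 0 ->
    exists y, diff A (k + 1) y = x.

(* f induces isomorphisms H_(k+1)(A) -> H_(k+1)(B), injectivity first *)
Definition weak_equivalence (A B : complex) (f : chain_map A B) : Prop :=
  forall k : int,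
    (forall x : A (k + 1), diff A k x = 0 ->
       (exists z, diff B (k + 1) z = f (k + 1) x) ->
       exists y, diff A (k + 1) y = x) /\
    (forall y : B (k + 1), diff B k y = 0 ->
       exists (x : A (k + 1)) (z : B (k + 1 + 1)),
         diff A k x = 0 /\ y = f (k + 1) x + diff B (k + 1) z).

Definition finite_complex (A : complex) : Prop :=
  exists (D : rmodType R) (inj : forall k : int, {linear A k -> D}),
    is_direct_sum inj /\ fin_gen D.

Definition h_finite (A : complex) : Prop :=
  exists F : complex,
    [/\ projective_complex F, finite_complex F & homotopy_equivalent A F].

Definition complex_exact (A B C : complex)
    (f : chain_map A B) (g : chain_map B C) : Prop :=
  forall k, mod_exact (f k) (g k).

(* Injective, with cokernel a complex of projective modules. *)
Definition cofibration (A B : complex) (f : chain_map A B) : Prop :=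
  exists (Q : complex) (g : chain_map B Q),
    projective_complex Q /\ complex_exact f g.

End Complexes.

Section TensorComplex.
Variables (R : pzRingType) (S : bimodule R) (A : complex R).

Lemma tensor_diff_diff (k : int) (x : tensor S (A (k + 1 + 1))) :
  tmap S (diff A k) (tmap S (diff A (k + 1)) x) = 0.
Proof.
elim/tensW: x => l; rewrite (tmapE (diff A (k + 1))) tmapE; apply/tclassP.
elim: l => [|[m s] l IHl] /=; first exact: tens_refl.
by rewrite diff_diff; exact: (tens_cat (tens_0l _ s) IHl).
Qed.

Definition tensor_complex : complex R :=
  @Complex R (fun k : int => tensor S (A k)) (fun k : int => tmap S (diff A k))
    tensor_diff_diff.

End TensorComplex.

Section D0.
Variables (R : pzRingType) (S : bimodule R).

(* d0_alpha i is the map alpha_(i+1).  As alpha_0 and lambda_(-1) do not exist,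
   the relation alpha_(i+1) lambda_i = (lambda_(i-1) (x) S) alpha_i concerns
   i >= 1 only. *)
Record d0complex := D0Complex {
  d0_cx :> nat -> complex R;
  d0_proj : forall i, projective_complex (d0_cx i);
  d0_lambda : forall i, chain_map (d0_cx i) (d0_cx i.+1);
  d0_alpha : forall i, chain_map (d0_cx i.+1) (tensor_complex S (d0_cx i));
  d0_compat : forall i (k : int) (x : d0_cx i.+1 k),
    d0_alpha i.+1 k (d0_lambda i.+1 k x) =
    tmap S (d0_lambda i k) (d0_alpha i k x) }.

Record d0map (X Y : d0complex) := D0Map {
  d0m :> forall i, chain_map (X i) (Y i);
  d0m_lambda : forall i (k : int) x,
    d0m i.+1 k (d0_lambda X i k x) = d0_lambda Y i k (d0m i k x);
  d0m_alpha : forall i (k : int) x,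
    tmap S (d0m i k) (d0_alpha X i k x) = d0_alpha Y i k (d0m i.+1 k x) }.

Definition d0_acyclic (X : d0complex) : Prop := forall i, acyclic (X i).

Definition d0_finite (X : d0complex) : Prop := forall i, finite_complex (X i).

Definition d0_exact (X Y Z : d0complex) (f : d0map X Y) (g : d0map Y Z) : Prop :=
  forall i, complex_exact (f i) (g i).

Definition reduced (X : d0complex) : Prop :=
  forall i k, surj (d0_alpha X i k).

Definition B_class (n : nat) (B : d0complex) : Prop :=
  [/\ zero_complex (B 0%N),
      forall i, h_finite (B i),
      forall i, cofibration (d0_lambda B i)
    & forall i, (n <= i)%N -> weak_equivalence (d0_lambda B i)].

Definition B_union (B : d0complex) : Prop := exists n, B_class n B.

Definition exact_class (P : d0complex -> Prop) : Prop :=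
  (forall X, d0_finite X -> d0_acyclic X -> P X) /\
  (forall X Y Z (f : d0map X Y) (g : d0map Y Z),
     d0_exact f g -> two_of_three (P X) (P Y) (P Z)).

Definition sum_stable (P : d0complex -> Prop) : Prop :=
  forall (T : Type) (F : T -> d0complex) (D : d0complex)
         (inj : forall t, d0map (F t) D),
    (forall i k, is_direct_sum (fun t => inj t i k)) ->
    (forall t, P (F t)) -> P D.

Definition completion (P : d0complex -> Prop) (X : d0complex) : Prop :=
  forall Q : d0complex -> Prop,
    exact_class Q -> sum_stable Q -> (forall Y, P Y -> Q Y) -> Q X.

Definition local (P : d0complex -> Prop) (X : d0complex) : Prop :=
  forall (Y : d0complex) (f : d0map Y X), P Y ->
  exists (E : d0complex) (g : d0map Y E) (h : d0map E X),
    d0_acyclic E /\ forall i (k : int) x, h i k (g i k x) = f i k x.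

End D0.

(* Main.v *)
From HB Require Import structures.
Require Import Defs.
From mathcomp Require Import all_boot all_order all_algebra.
From mathcomp Require Import boolp zify.
Set Implicit Arguments.
Unset Strict Implicit.
Unset Printing Implicit Defensive.
Import Order.TTheory GRing.Theory Num.Theory.
Local Open Scope ring_scope.

(** Contractible implies local. Let [f : Y -> X] with [Y] in B_n and [X i]
    acyclic for [i <= n]. Put [m i = min i n]. The pushouts
      [E i = X (m i) +_(Y (m i)) Y i]
    form a D0-complex through which [f] factors, the map alpha on the summand
    [X (m i.+1)] being a transition map of [X] followed by alpha. Since
    [Y (m i) -> Y i] is a cofibration and a weak equivalence and [X (m i)] is
    acyclic, [E] is acyclic ([pushout_factorization], [local_of_acyclic]).

    Local implies contractible, by induction on the index. Suppose [X i] is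
    contractible; then so is its tensor product with [S], and since alpha is
    surjective every cycle of [X i.+1] is homologous to a cycle [z] killed by
    alpha. Such a [z] is the image of a generator under a morphism from the
    D0-complex of B_n equal to [R], in a single degree, at all indices greater
    than [i], with transition maps the identity and alpha equal to 0. Locality
    factors this morphism through an acyclic D0-complex, so [z] is a boundary,
    and [X i.+1] is acyclic ([local_acyclic]).

    Acyclic terms are contractible in the completion of B. Fix a class [P] of
    complexes closed under desuspension. The complexes all of whose desuspensions
    have only null-homotopic chain maps into members of [P] are closed under two
    out of three in short exact sequences with projective quotient, which split
    in each degree, and under direct sums. For [P] the acyclic complexes, they
    contain the h-finite complexes, because a bounded complex of projectives has
    only null-homotopic maps into an acyclic complex; applied to the identity of
    an acyclic term this is [completion_acyclic_contractible]. For [P] all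
    complexes and the index 0, where the members of B vanish, the same argument
    shows that [X 0] is contractible ([completion_acyclic0]). *)

(** * Submodules and split exact sequences *)

(** A submodule, given by an arbitrary predicate rather than a boolean one. *)

Record submodule (R : pzRingType) (M : rmodType R) := Submodule {
  in_submodule : M -> Prop;
  submodule0 : in_submodule 0;
  submoduleP : forall (a : R^c) x y,
    in_submodule x -> in_submodule y -> in_submodule (a *: x + y) }.

Section SubmoduleType.
Variables (R : pzRingType) (M : rmodType R) (U : submodule M).

Definition submod_pred : {pred M} := fun x => `[< in_submodule U x >].

Lemma submod_pred_closed : submod_closed submod_pred.
Proof.
split=> [|a x y /asboolP Ux /asboolP Uy]; apply/asboolP; first exact: submodule0.
exact: submoduleP.
Qed.

HB.instance Definition _ :=
  GRing.isSubmodClosed.Build R^c M submod_pred submod_pred_closed.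

(** A submodule as a module in its own right. *)
Record submod_type : Type := SubmodType {
  submod_val : M; submod_valP : submod_val \in submod_pred }.

HB.instance Definition _ := [isSub for submod_val].
HB.instance Definition _ := [Choice of submod_type by <:].
HB.instance Definition _ := [SubChoice_isSubLmodule of submod_type by <:].

Definition submod_incl : {linear submod_type -> M} :=
  (\val : submod_type -> M).

Lemma submod_inclP x : in_submodule U (submod_incl x).
Proof. by apply/asboolP; exact: (submod_valP x). Qed.

Lemma submod_inclE x (Ux : x \in submod_pred) :
  submod_incl (SubmodType Ux) = x.
Proof. by []. Qed.

Lemma submod_incl_inj : injective submod_incl.
Proof. exact: val_inj. Qed.

End SubmoduleType.

Section LinearTools.
Variable R : pzRingType.
Implicit Types L M N P : rmodType R.

(** A function bundled with a proof of its linearity. *)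
Definition mklin M N (f : M -> N) (lf : linear f) : {linear M -> N} :=
  HB.pack f (GRing.isLinear.Build R^c M N *:%R f lf).

Lemma corestriction M N (U : submodule M) (f : {linear N -> M}) :
  (forall x, in_submodule U (f x)) ->
  exists g : {linear N -> submod_type U}, forall x, submod_incl U (g x) = f x.
Proof.
move=> Uf.
have Uf' x : f x \in submod_pred U by apply/asboolP.
have lin : linear (fun x => SubmodType (Uf' x)).
  by move=> a x y; apply: submod_incl_inj;
     rewrite [RHS]linearP !submod_inclE linearP.
by exists (mklin lin).
Qed.

(** The kernel of a linear map. *)
Definition kernel M N (f : {linear M -> N}) : submodule M.
Proof.
apply: (@Submodule R M (fun x => f x = 0)); first exact: linear0.
by move=> a x y fx fy; rewrite linearP fx fy scaler0 addr0.
Defined.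

(** A map from a projective module into the kernel of [g] lifts along [f] when
    [f] and [g] are exact in the middle. *)
Lemma projective_lift_exact P M N L (f : {linear M -> N}) (g : {linear N -> L})
    (u : {linear P -> N}) :
  projective P -> (forall y, g y = 0 -> exists x, f x = y) ->
  (forall x, g (f x) = 0) -> (forall x, g (u x) = 0) ->
  exists v : {linear P -> M}, forall x, f (v x) = u x.
Proof.
move=> projP ex gf gu.
have [f' f'E] := corestriction (U := kernel g) gf.
have [u' u'E] := corestriction (U := kernel g) gu.
have surjf' : surj f'.
  move=> y; have [x fx] := ex _ (submod_inclP y).
  by exists x; apply: submod_incl_inj; rewrite f'E.
have [v vE] := projP _ _ f' u' surjf'.
by exists v => x; rewrite -f'E vE u'E.
Qed.

(** A short exact sequence with projective quotient splits: [s] is a section of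
    the projection and [r] the complementary retraction of the inclusion. *)
Lemma exact_split M N P (f : {linear M -> N}) (g : {linear N -> P}) :
  mod_exact f g -> projective P ->
  exists (s : {linear P -> N}) (r : {linear N -> M}),
    [/\ forall x, g (s x) = x, forall x, r (f x) = x
      & forall y, y = f (r y) + s (g y)].
Proof.
move=> [injf exf surjg] projP.
have [s sE] := projP _ _ g idfun surjg.
have gfE x : g (f x) = 0 by apply/exf; exists x.
have ker y : exists x, f x = y - s (g y).
  by apply/exf; rewrite linearB /= sE subrr.
pose r y := projT1 (cid (ker y)).
have fr y : f (r y) = y - s (g y) by rewrite /r; case: cid.
have lr : linear r.
  move=> a x y; apply: injf; rewrite [RHS]linearP !fr (linearP g) (linearP s).
  by rewrite scalerBr opprD addrACA.
exists s, (mklin lr); split=> //= x; last by rewrite fr subrK.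
by apply: injf; rewrite fr gfE linear0 subr0.
Qed.
End LinearTools.

(** * Families indexed by the integers *)

(** Choice for a family of types. *)
Lemma choice_dep I (T : I -> Type) (Q : forall i, T i -> Prop) :
  (forall i, exists y, Q i y) -> exists f : forall i, T i, forall i, Q i (f i).
Proof.
move=> ex; exists (fun i => projT1 (cid (ex i))) => i.
by case: (cid (ex i)).
Qed.

Lemma sub_add_sub (V : zmodType) (a b c : V) : a - b = c - b + a - c.
Proof. by rewrite addrAC (addrAC c) subrr add0r addrC. Qed.

Lemma int_succ_ind (Q : int -> Prop) :
  (forall k, Q (k + 1)) -> forall k, Q k.
Proof. by move=> Qs k; rewrite -(subrK 1 k). Qed.

(** A family given in the degrees [k + 1] is a family given in all degrees. *)
Lemma int_succ_family (T : int -> Type) (u : forall k : int, T (k + 1)) :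
  exists f : forall k, T k, forall k : int, f (k + 1) = u k.
Proof.
exists (fun k => ecast j (T j) (subrK 1 k) (u (k - 1))) => k.
move: (subrK 1 (k + 1)); have -> : k + 1 - 1 = k by rewrite addrK.
by move=> e; rewrite eq_axiomK.
Qed.

(** * Shifts and null-homotopic maps *)

Section NullHomotopy.
Variable R : pzRingType.
Implicit Types A B C E F : complex R.

(** Composite and identity chain maps. *)
Definition chain_comp A B C (g : chain_map B C) (f : chain_map A B) :
  chain_map A C.
Proof.
apply: (@ChainMap R A C (fun k => (g k \o f k : {linear A k -> C k}))) => k x.
by rewrite /= !cmap_diff.
Defined.

Definition chain_id A : chain_map A A :=
  @ChainMap R A A (fun k => idfun : {linear A k -> A k}) (fun k x => erefl).

(** The desuspension, whose term of degree [k] is [A (k + 1)]; the sign of the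
    differential makes homotopies between chain maps into chain maps. *)
Definition shift A : complex R.
Proof.
apply: (@Complex R (fun k => A (k + 1))
  (fun k => (\- diff A (k + 1) : {linear _ -> _}))) => k x.
by rewrite /= linearN opprK diff_diff.
Defined.

Lemma shift_diffE A k (x : A (k + 1 + 1)) :
  diff (shift A) k x = - diff A (k + 1) x.
Proof. by []. Qed.

Definition shift_map A B (f : chain_map A B) : chain_map (shift A) (shift B).
Proof.
apply: (@ChainMap R (shift A) (shift B) (fun k => f (k + 1))) => k x.
by rewrite !shift_diffE linearN cmap_diff.
Defined.

(** [f] is chain homotopic to 0. *)
Definition null_homotopic A B (f : chain_map A B) : Prop :=
  exists h : forall k : int, {linear A k -> B (k + 1)},
    forall (k : int) x,
      f (k + 1) x = diff B (k + 1) (h (k + 1) x) + h k (diff A k x).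

(** Every chain map from [A] to a member of [P] is null-homotopic. *)
Definition null_into (P : complex R -> Prop) A : Prop :=
  forall E, P E -> forall f : chain_map A E, null_homotopic f.

(** The splittings are chosen degree by degree and do not commute with the
    differentials. *)
Lemma complex_split A B C (i : chain_map A B) (p : chain_map B C) :
  complex_exact i p -> projective_complex C ->
  exists (s : forall k, {linear C k -> B k}) (r : forall k, {linear B k -> A k}),
    forall k, [/\ forall x, p k (s k x) = x, forall x, r k (i k x) = x
      & forall y, y = i k (r k y) + s k (p k y)].
Proof.
move=> ex projC.
have [s sP] := choice_dep (fun k => exact_split (ex k) (projC k)).
by have [r rP] := choice_dep sP; exists s, r.
Qed.

(** Two out of three for null-homotopic maps. A graded map [w] on [B] vanishing on
    [A] is [w = (w s) p], hence factors through [C]; the factor commutes with the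
    differentials when [w] does, because [p] is surjective. *)
Section TwoOfThree.
Variables (P : complex R -> Prop) (A B C : complex R).
Variables (i : chain_map A B) (p : chain_map B C).
Hypotheses (ex : complex_exact i p) (projC : projective_complex C).

Let pi0 k x : p k (i k x) = 0.
Proof. by have [_ exk _] := ex k; apply/exk; exists x. Qed.

Lemma null_into_extension : null_into P A -> null_into P C -> null_into P B.
Proof.
have [s [r sr]] := complex_split ex projC.
move=> nullA nullC E PE f.
have [h hE] := nullA E PE (chain_comp f i).
(* The extension by the retraction of a null-homotopy on A, subtracted from f,
   leaves a chain map which vanishes on A. *)
pose w k : {linear B (k + 1) -> E (k + 1)} :=
  f (k + 1) \- ((diff E (k + 1) \o h (k + 1) \o r (k + 1))
             \+ (h k \o r k \o diff B k)).
have wE k x : w k x = f (k + 1) x -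
    (diff E (k + 1) (h (k + 1) (r (k + 1) x)) + h k (r k (diff B k x))) by [].
have wi k x : w k (i (k + 1) x) = 0.
  have [_ ri _] := sr (k + 1); have [_ ri' _] := sr k.
  by rewrite wE -cmap_diff ri ri' -[f _ _]/(chain_comp f i (k + 1) x) hE subrr.
have [v vE] := @int_succ_family (fun k => {linear C k -> E k})
  (fun k => (w k \o s (k + 1) : {linear C (k + 1) -> E (k + 1)})).
have vp k x : v (k + 1) (p (k + 1) x) = w k x.
  have [_ _ y] := sr (k + 1).
  by rewrite vE [in RHS](y x) linearD wi add0r.
have v_diff k x : v k (diff C k x) = diff E k (v (k + 1) x).
  elim/int_succ_ind: k x => k x.
  have [_ _ /(_ x)[b <-]] := ex (k + 1 + 1).
  rewrite -cmap_diff !vp !wE diff_diff !linear0 addr0 linearB linearD.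
  by rewrite diff_diff add0r -cmap_diff.
have [hC hCE] := nullC E PE (ChainMap v_diff).
exists (fun k => ((h k \o r k) \+ (hC k \o p k) : {linear _ -> _})) => k x.
rewrite /= !linearD addrACA cmap_diff -hCE /= vp wE.
by rewrite addrC subrK.
Qed.

Lemma null_into_quotient : (forall E, P E -> P (shift E)) ->
  null_into P A -> null_into P B -> null_into P C.
Proof.
have [s [r sr]] := complex_split ex projC.
move=> Pshift nullA nullB E PE f.
have [h hE] := nullB E PE (chain_comp f p).
(* On A the homotopy h bounds 0, so it is a chain map into the desuspension. *)
pose a k : {linear A k -> shift E k} := h k \o i k.
have a_diff k x : a k (diff A k x) = diff (shift E) k (a (k + 1) x).
  rewrite shift_diffE /= cmap_diff; apply/eqP; rewrite -addr_eq0.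
  by rewrite [X in X == 0]addrC -hE /= pi0 linear0.
have [u uE] := nullA _ (Pshift E PE) (ChainMap a_diff).
(* Correcting h by the boundary of an extension of u makes it vanish on A. *)
pose w k : {linear B (k + 1) -> E (k + 1 + 1)} :=
  h (k + 1) \- (((\- (diff E (k + 1 + 1)) : {linear _ -> _})
                   \o u (k + 1) \o r (k + 1))
             \+ (u k \o r k \o diff B k)).
have wE k x : w k x = h (k + 1) x -
    (- diff E (k + 1 + 1) (u (k + 1) (r (k + 1) x)) + u k (r k (diff B k x))).
  by [].
have wi k x : w k (i (k + 1) x) = 0.
  have [_ ri _] := sr (k + 1); have [_ ri' _] := sr k.
  by rewrite wE -cmap_diff ri ri' -[h _ _]/(a (k + 1) x) uE subrr.
have [v vE] := @int_succ_family (fun k => {linear C k -> E (k + 1)})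
  (fun k => (w k \o s (k + 1) : {linear C (k + 1) -> E (k + 1 + 1)})).
have vp k x : v (k + 1) (p (k + 1) x) = w k x.
  have [_ _ y] := sr (k + 1).
  by rewrite vE [in RHS](y x) linearD wi add0r.
exists v; elim/int_succ_ind=> k x.
have [_ _ /(_ x)[b <-]] := ex (k + 1 + 1).
rewrite -cmap_diff !vp !wE diff_diff !linear0 addr0 linearB linearD linearN /=.
rewrite diff_diff oppr0 add0r opprK addrACA addNr addr0.
by rewrite -hE.
Qed.

Lemma null_into_sub :
  null_into P B -> null_into P (shift C) -> null_into P A.
Proof.
have [s [r sr]] := complex_split ex projC.
move=> nullB nullC E PE f.
(* The extension g of f commutes with the differentials up to w, which is a
   chain map on the desuspension of C. *)
pose g k : {linear B k -> E k} := f k \o r k.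
pose w k : {linear B (k + 1) -> E k} :=
  (diff E k \o g (k + 1)) \- (g k \o diff B k).
have wE k x : w k x = diff E k (g (k + 1) x) - g k (diff B k x) by [].
have wi k x : w k (i (k + 1) x) = 0.
  have [_ ri _] := sr (k + 1); have [_ ri' _] := sr k.
  by rewrite wE /= ri -!cmap_diff ri' subrr.
pose v k : {linear shift C k -> E k} := w k \o s (k + 1).
have vp k x : v k (p (k + 1) x) = w k x.
  have [_ _ y] := sr (k + 1).
  by rewrite [in RHS](y x) linearD wi add0r.
have v_diff k x : v k (diff (shift C) k x) = diff E k (v (k + 1) x).
  have [_ _ /(_ x)[b <-]] := ex (k + 1 + 1).
  rewrite shift_diffE -cmap_diff linearN !vp !wE diff_diff linear0 subr0 linearB.
  by rewrite diff_diff add0r.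
have [u0 u0E] := nullC E PE (ChainMap v_diff).
have [u uE] := @int_succ_family (fun k => {linear C k -> E k}) u0.
(* A null-homotopy of w corrects g into a chain map G extending f. *)
pose G k : {linear B k -> E k} := g k \- (u k \o p k).
have G_diff k x : G k (diff B k x) = diff E k (G (k + 1) x).
  elim/int_succ_ind: k x => k x.
  have key : w (k + 1) x = diff E (k + 1) (u (k + 1 + 1) (p (k + 1 + 1) x))
                           - u (k + 1) (p (k + 1) (diff B (k + 1) x)).
    by rewrite -vp u0E shift_diffE linearN !uE cmap_diff.
  have GE j y : G j y = g j y - u j (p j y) by [].
  move: key; rewrite wE !GE linearB => /eqP; rewrite subr_eq => /eqP ->.
  exact: sub_add_sub.
have [h hE] := nullB E PE (ChainMap G_diff).
exists (fun k => (h k \o i k : {linear _ -> _})) => k x.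
have [_ ri _] := sr (k + 1).
rewrite /= cmap_diff -hE /G /= ri pi0 linear0 subr0.
by [].
Qed.

End TwoOfThree.

Lemma null_into_direct_sum (P : complex R -> Prop) (T : Type)
    (F : T -> complex R) (D : complex R) (inj : forall t, chain_map (F t) D) :
  (forall k, is_direct_sum (fun t => inj t k)) ->
  (forall t, null_into P (F t)) -> null_into P D.
Proof.
move=> sumD nullF E PE f.
have [h hE] := choice_dep (fun t => nullF t E PE (chain_comp f (inj t))).
have [H HE] := choice_dep (fun k => sumD k _ (fun t => h t k)).
exists H => k x.
have [g [_ uniq]] := sumD (k + 1) _
  (fun t => (f (k + 1) \o inj t (k + 1) : {linear _ -> _})).
rewrite (uniq (f (k + 1))) //.
rewrite -(uniq ((diff E (k + 1) \o H (k + 1)) \+ (H k \o diff D k))) //= => t y.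
have [Hk _] := HE k; have [Hk1 _] := HE (k + 1).
by rewrite Hk1 -cmap_diff Hk -hE.
Qed.

(** [A] is a retract of [F] up to homotopy. *)
Definition dominated A F : Prop :=
  exists (r : chain_map A F) (j : chain_map F A)
         (t : forall k : int, {linear A k -> A (k + 1)}),
    forall (k : int) x,
      x = j (k + 1) (r (k + 1) x) -
          (diff A (k + 1) (t (k + 1) x) + t k (diff A k x)).

Lemma null_into_dominated (P : complex R -> Prop) A F :
  dominated A F -> null_into P F -> null_into P A.
Proof.
move=> [r [j [t rj]]] nullF E PE f.
have [h hE] := nullF E PE (chain_comp f j).
exists (fun k => (h k \o r k) \- (f (k + 1) \o t k) : {linear _ -> _}) => k x.
rewrite [in LHS](rj k x) linearB linearD /= linearB addrACA -opprD.
by rewrite (cmap_diff r) -hE /= -cmap_diff.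
Qed.

Lemma dominated_shift A F : dominated A F -> dominated (shift A) (shift F).
Proof.
move=> [r [j [t rj]]]; exists (shift_map r), (shift_map j).
exists (fun k => \- t (k + 1) : {linear _ -> _}) => k x.
by rewrite !shift_diffE /= !linearN !opprK; exact: rj.
Qed.

Lemma contractible_null_into P A : contractible A -> null_into P A.
Proof.
move=> [s sE] E _ f.
exists (fun k => f (k + 1) \o s k : {linear _ -> _}) => k x.
by rewrite /= -cmap_diff -linearD -sE subr0.
Qed.

Lemma contractible_shift A : contractible A -> contractible (shift A).
Proof.
move=> [s sE]; exists (fun k => \- s (k + 1) : {linear _ -> _}) => k x.
by rewrite /= !linearN !opprK -sE.
Qed.

Lemma contractible_acyclic A : contractible A -> acyclic A.
Proof.
move=> [s sE] k x dx0; exists (s (k + 1) x).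
by have := sE k x; rewrite subr0 dx0 linear0 addr0.
Qed.

Lemma acyclic_shift A : acyclic A -> acyclic (shift A).
Proof.
move=> acA k x; rewrite shift_diffE => /eqP; rewrite oppr_eq0 => /eqP dx0.
by have [y dy] := acA _ _ dx0; exists (- y); rewrite shift_diffE linearN opprK.
Qed.

Lemma null_homotopic_id_contractible A :
  null_homotopic (chain_id A) -> contractible A.
Proof. by move=> [h hE]; exists h => k x; rewrite subr0 -hE. Qed.

Lemma acyclic_contractible A :
  acyclic A -> null_into (@acyclic R) A -> contractible A.
Proof. by move=> acA nullA; apply/null_homotopic_id_contractible/nullA. Qed.

(** A complex of projective modules vanishing outside finitely many degrees. *)
Definition bounded_projective A : Prop :=
  projective_complex A /\
  exists N : nat, forall k : int, (N < `|k|)%N -> forall x : A k, x = 0.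

Lemma bounded_projective_shift A :
  bounded_projective A -> bounded_projective (shift A).
Proof.
move=> [projA [N bndA]]; split; first by move=> k; exact: projA.
by exists N.+1 => k ltNk; apply: bndA; lia.
Qed.

(** The null-homotopy is built by induction on the degree, starting below the
    lower bound; the upper bound stops the induction. *)
Lemma bounded_projective_null_into A :
  bounded_projective A -> null_into (@acyclic R) A.
Proof.
move=> [projA [N bndA]] E acE f.
have step (m : nat) : exists h : forall k : int, {linear A k -> E (k + 1)},
    forall k : int, k <= m%:Z - N%:Z - 2 -> forall x,
      f (k + 1) x = diff E (k + 1) (h (k + 1) x) + h k (diff A k x).
  elim: m => [|m [h hE]].
    exists (fun k => \0 : {linear A k -> E (k + 1)}) => k lek x.
    have -> : x = 0 by apply: bndA; lia.
    by rewrite !linear0 /= addr0.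
  (* The next component v of h solves d v = g, where g lands in the cycles by the
     homotopy identity in the previous degree. *)
  set c := m%:Z - N%:Z - 2 in hE.
  pose g : {linear A (c + 1 + 1) -> E (c + 1 + 1)} :=
    f (c + 1 + 1) \- (h (c + 1) \o diff A (c + 1)).
  have dg x : diff E (c + 1) (g x) = 0.
    by rewrite linearB /= -cmap_diff hE // diff_diff linear0 addr0 subrr.
  have [v vE] := projective_lift_exact (f := diff E (c + 1 + 1))
    (projA _) (@acE (c + 1)) (@diff_diff R E (c + 1)) dg.
  exists (dfwith h v) => k lek x; have [ltk|] := leP k c.
    by rewrite !dfwith_out ?hE //; apply/eqP; lia.
  move=> ltck; have ek : k = c + 1 by lia.
  subst k; rewrite dfwith_in dfwith_out; last by apply/eqP; lia.
  by rewrite vE /g /= subrK.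
have [h hE] := step (2 * N + 4)%N; exists h => k x.
have [lek|gtk] := leP k ((2 * N + 4)%N%:Z - N%:Z - 2); first exact: hE.
have -> : x = 0 by apply: bndA; lia.
by rewrite !linear0 addr0.
Qed.

(** * Complexes all of whose desuspensions map trivially *)

(** Every chain map from a desuspension of [A] to a member of [P] is
    null-homotopic. Unlike [null_into P], this satisfies two out of three:
    [null_into_sub] needs a desuspension. *)
Definition all_null_into (P : complex R -> Prop) A : Prop :=
  forall m, null_into P (iter m shift A).

(** A class stable under desuspension need only be checked on its members. *)
Lemma all_null_into_stable P (Q : complex R -> Prop) A :
  (forall B, Q B -> Q (shift B)) -> (forall B, Q B -> null_into P B) ->
  Q A -> all_null_into P A.
Proof.
by move=> Qshift Qnull QA m; apply: Qnull; elim: m => //= m; exact: Qshift.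
Qed.

Lemma contractible_all_null_into P A : contractible A -> all_null_into P A.
Proof.
apply: all_null_into_stable; first exact: contractible_shift.
by move=> B; exact: contractible_null_into.
Qed.

Lemma dominated_all_null_into A F :
  dominated A F -> bounded_projective F -> all_null_into (@acyclic R) A.
Proof.
move=> domAF bpF.
apply: (@all_null_into_stable _
  (fun B => exists2 G, dominated B G & bounded_projective G)).
- move=> B [G domBG bpG]; exists (shift G); first exact: dominated_shift.
  exact: bounded_projective_shift.
- move=> B [G domBG bpG].
  exact: null_into_dominated domBG (bounded_projective_null_into bpG).
- by exists F.
Qed.

Lemma all_null_into_two_of_three P A B C (i : chain_map A B) (p : chain_map B C) :
  (forall E, P E -> P (shift E)) -> complex_exact i p -> projective_complex C ->
  two_of_three (all_null_into P A) (all_null_into P B) (all_null_into P C).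
Proof.
move=> Pshift ex projC.
have ex_iter m : exists (i' : chain_map (iter m shift A) (iter m shift B))
    (p' : chain_map (iter m shift B) (iter m shift C)),
    complex_exact i' p' /\ projective_complex (iter m shift C).
  elim: m => [|m [i' [p' [ex' proj']]]]; first by exists i, p.
  exists (shift_map i'), (shift_map p').
  by split=> k; [exact: ex' | exact: proj'].
split=> n1 n2 m; have [i' [p' [ex' proj']]] := ex_iter m.
- exact: null_into_quotient ex' proj' Pshift (n1 m) (n2 m).
- exact: null_into_extension ex' proj' (n1 m) (n2 m).
- exact: null_into_sub ex' proj' (n1 m) (n2 m.+1).
Qed.

Lemma all_null_into_direct_sum (P : complex R -> Prop) (T : Type)
    (F : T -> complex R) (D : complex R) (inj : forall t, chain_map (F t) D) :
  (forall k, is_direct_sum (fun t => inj t k)) ->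
  (forall t, all_null_into P (F t)) -> all_null_into P D.
Proof.
move=> sumD nullF m.
have [inj' sumD'] : exists inj' : forall t,
    chain_map (iter m shift (F t)) (iter m shift D),
    forall k, is_direct_sum (fun t => inj' t k).
  elim: m => [|m [inj' sumD']]; first by exists inj.
  by exists (fun t => shift_map (inj' t)) => k; exact: sumD'.
by apply: null_into_direct_sum sumD' _ => t; exact: nullF.
Qed.

End NullHomotopy.

(** * Finite complexes *)

Section FiniteComplexes.
Variable R : pzRingType.
Implicit Types A : complex R.

(** A direct sum that is finitely generated has finitely many nonzero terms. *)
Lemma finite_complex_bounded A : finite_complex A ->
  exists N : nat, forall k : int, (N < `|k|)%N -> forall x : A k, x = 0.
Proof.
move=> [D [inj [sumD [n [e genD]]]]].
(* The map delta k t is the identity if t = k and 0 otherwise; these induce the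
   projection pr k of D onto A k. *)
pose delta k : forall t, {linear A t -> A k} :=
  dfwith (fun t => \0 : {linear A t -> A k}) (idfun : {linear A k -> A k}).
have [pr prE] := choice_dep (fun k => sumD (A k) (delta k)).
have pr_inj k t x : pr k (inj t x) = delta k t x by have [-> _] := prE k.
(* The elements of finite support form a submodule containing all the terms,
   hence everything. *)
pose fin d := exists N : nat, forall k : int, (N < `|k|)%N -> pr k d = 0.
have fin0 : fin 0 by exists 0%N => k _; rewrite linear0.
have finP (a : R^c) x y : fin x -> fin y -> fin (a *: x + y).
  move=> [Nx xE] [Ny yE]; exists (maxn Nx Ny) => k.
  rewrite gtn_max => /andP[ltx lty].
  by rewrite linearP xE ?yE // scaler0 addr0.
pose U := Submodule fin0 finP.
have injU t x : in_submodule U (inj t x).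
  exists `|t|%N => k ltk; rewrite pr_inj /delta dfwith_out //.
  by apply/eqP => ekt; rewrite ekt ltnn in ltk.
have [injU' injU'E] := choice_dep (fun t => corestriction (injU t)).
have [h [hE _]] := sumD _ injU'.
have [h0 [_ uniq]] := sumD D inj.
have finD d : in_submodule U d.
  rewrite -[d]/((idfun : {linear D -> D}) d) uniq //.
  rewrite -(uniq (submod_incl U \o h)); first exact: submod_inclP.
  by move=> t x; rewrite -[LHS]/(submod_incl U (h (inj t x))) hE injU'E.
have [N NE] := choice (fun i => finD (e i)).
exists (\max_i N i) => k ltk x.
have -> : x = pr k (inj k x) by rewrite pr_inj /delta dfwith_in.
have [c ->] := genD (inj k x).
rewrite linear_sum big1 // => i _; rewrite linearZ_LR NE ?scaler0 //.
by apply: leq_ltn_trans ltk; exact: leq_bigmax.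
Qed.

Lemma finite_complex_bounded_projective A :
  projective_complex A -> finite_complex A -> bounded_projective A.
Proof. by move=> projA finA; split=> //; exact: finite_complex_bounded. Qed.

Lemma bounded_projective_acyclic_contractible A :
  bounded_projective A -> acyclic A -> contractible A.
Proof.
move=> bpA acA; apply: acyclic_contractible acA _.
exact: bounded_projective_null_into.
Qed.

Lemma homotopy_equivalent_dominated A F :
  homotopy_equivalent A F -> dominated A F.
Proof.
move=> [r [j [[t tE] _]]]; exists r, j, t => k x.
by rewrite -tE opprB [RHS]addrC subrK.
Qed.

Lemma h_finite_all_null_into A : h_finite A -> all_null_into (@acyclic R) A.
Proof.
move=> [F [projF finF /homotopy_equivalent_dominated domAF]].
apply: dominated_all_null_into domAF _.
exact: finite_complex_bounded_projective projF finF.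
Qed.

Lemma finite_h_finite A :
  projective_complex A -> finite_complex A -> h_finite A.
Proof.
move=> projA finA; exists A; split=> //.
exists (chain_id A), (chain_id A).
split; exists (fun k => \0 : {linear _ -> _}) => k x /=;
  by rewrite linear0 addr0; apply: subrr.
Qed.

Lemma zero_complex_contractible A : zero_complex A -> contractible A.
Proof.
move=> zA; exists (fun k => \0 : {linear _ -> _}) => k x.
by rewrite (zA _ x) !linear0 !addr0.
Qed.

End FiniteComplexes.

(** * The completion *)

Section Completion.
Variables (R : pzRingType) (S : bimodule R).
Implicit Types X Y : d0complex S.

(** Membership in the class of D0-complexes whose term of index [i] has this
    property passes from [Q] to its completion. *)
Lemma completion_all_null_into (P : complex R -> Prop) (i : nat)
    (Q : d0complex S -> Prop) :
  (forall E, P E -> P (shift E)) ->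
  (forall X, d0_finite X -> d0_acyclic X -> all_null_into P (X i)) ->
  (forall X, Q X -> all_null_into P (X i)) ->
  forall X, completion Q X -> all_null_into P (X i).
Proof.
move=> Pshift Pac PQ X BX; apply: (BX (fun Y => all_null_into P (Y i))) => //.
  split=> // X1 X2 X3 f g ex.
  exact: all_null_into_two_of_three Pshift (ex i) (@d0_proj _ _ X3 i).
by move=> T F D inj sumD; apply: all_null_into_direct_sum (sumD i).
Qed.

Lemma completion_acyclic_contractible X i :
  completion (@B_union R S) X -> acyclic (X i) -> contractible (X i).
Proof.
move=> BX acX; apply: acyclic_contractible (acX) _.
suff nullX : all_null_into (@acyclic R) (X i) by exact: nullX 0%N.
apply: (completion_all_null_into (@acyclic_shift R) _ _ BX) => Y.
  move=> finY acY; apply: contractible_all_null_into.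
  apply: bounded_projective_acyclic_contractible (acY i).
  exact: finite_complex_bounded_projective (@d0_proj _ _ Y i) (finY i).
by move=> [n [_ hfinY _ _]]; exact: h_finite_all_null_into.
Qed.

(** The members of B vanish at the index 0. *)
Lemma completion_acyclic0 X :
  completion (@B_union R S) X -> acyclic (X 0%N).
Proof.
move=> BX; apply: contractible_acyclic.
have nullX : all_null_into (fun=> True) (X 0%N).
  apply: (completion_all_null_into _ _ _ BX) => // Y.
    move=> finY acY; apply: contractible_all_null_into.
    apply: bounded_projective_acyclic_contractible (acY 0%N).
    exact: finite_complex_bounded_projective (@d0_proj _ _ Y 0%N) (finY 0%N).
  move=> [n [zY _ _ _]].
  exact: contractible_all_null_into (zero_complex_contractible zY).
exact: null_homotopic_id_contractible (nullX 0%N _ I (chain_id _)).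
Qed.

End Completion.

(** * Functoriality of the tensor product *)

Section TensorFunctor.
Variables (R : pzRingType) (S : bimodule R).
Implicit Types M N L : rmodType R.

Lemma tmap_comp M N L (f : {linear M -> N}) (g : {linear N -> L})
    (h : {linear M -> L}) x :
  (forall y, g (f y) = h y) -> tmap S g (tmap S f x) = tmap S h x.
Proof.
move=> ghf; elim/tensW: x => l; rewrite (tmapE f) !tmapE; congr tclass.
by rewrite /tmap_seq -map_comp; apply: eq_map => -[m s] /=; rewrite ghf.
Qed.

Lemma tmap_id M (f : {linear M -> M}) x :
  (forall y, f y = y) -> tmap S f x = x.
Proof.
move=> fid; elim/tensW: x => l; rewrite tmapE; congr tclass.
by rewrite -[RHS]map_id; apply: eq_map => -[m s] /=; rewrite fid.
Qed.

Lemma tmap_commute M N N' L (f : {linear M -> N}) (g : {linear N -> L})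
    (f' : {linear M -> N'}) (g' : {linear N' -> L}) x :
  (forall y, g (f y) = g' (f' y)) ->
  tmap S g (tmap S f x) = tmap S g' (tmap S f' x).
Proof.
move=> e; rewrite (tmap_comp (h := (g' \o f' : {linear M -> L}))) //.
by rewrite [RHS](tmap_comp (h := (g' \o f' : {linear M -> L}))).
Qed.

Lemma tmap_add M N (f g h : {linear M -> N}) x :
  (forall y, h y = f y + g y) -> tmap S h x = tmap S f x + tmap S g x.
Proof.
move=> hfg; elim/tensW: x => l; rewrite !tmapE.
elim: l => [|[m c] l IHl] /=; first by rewrite -tclass_cat.
have cons p (l' : seq (N * S)) :
  tclass S (p :: l') = tclass S [:: p] + tclass S l' by rewrite -tclass_cat.
rewrite cons IHl (cons (f m, c)) (cons (g m, c)) addrACA; congr (_ + _).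
by rewrite -tclass_cat /= hfg; apply/tclassP; exact: tens_Dl.
Qed.

Lemma tensor_contractible (A : complex R) :
  contractible A -> contractible (tensor_complex S A).
Proof.
move=> [s sE]; exists (fun k => tmap S (s k)) => k x.
rewrite subr0 /= -[LHS](tmap_id (f := idfun)) //.
pose f : {linear A (k + 1) -> A (k + 1)} := diff A (k + 1) \o s (k + 1).
pose g : {linear A (k + 1) -> A (k + 1)} := s k \o diff A k.
rewrite (tmap_comp (h := f)) // (tmap_comp (h := g)) //.
by apply: tmap_add => y; rewrite -[LHS]subr0; exact: sE.
Qed.

End TensorFunctor.

(** * Iterated transition maps of a D0-complex *)

Lemma leq_ind_from a (Q : nat -> Prop) :
  Q a -> (forall b, (a <= b)%N -> Q b -> Q b.+1) -> forall b, (a <= b)%N -> Q b.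
Proof.
move=> Qa QS; elim=> [|b IHb]; first by rewrite leqn0 => /eqP <-.
by rewrite leq_eqVlt => /predU1P[<- //|ltab]; apply: QS => //; exact: IHb.
Qed.

Section Transition.
Variables (R : pzRingType) (S : bimodule R).
Implicit Types X Y : d0complex S.

(** The composite of the maps lambda from the index [a] to the index [b],
    with the arbitrary value 0 when [b < a]. *)
Fixpoint transition X (a b : nat) (k : int) : {linear X a k -> X b k} :=
  match a =P b with
  | ReflectT e => ecast c {linear X a k -> X c k} e idfun
  | ReflectF _ => match b with
    | 0%N => \0
    | b'.+1 => d0_lambda X b' k \o transition X a b' k
    end
  end.

Lemma transition_id X a k x : transition X a a k x = x.
Proof. by case: a x => [|a] x /=; case: eqP => // e; rewrite eq_axiomK. Qed.

Lemma transitionS X a b k x : (a <= b)%N ->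
  transition X a b.+1 k x = d0_lambda X b k (transition X a b k x).
Proof.
by move=> leab /=; case: eqP => // e; rewrite e ltnn in leab.
Qed.

Arguments transition : simpl never.

Lemma transition_diff X a b k x : (a <= b)%N ->
  transition X a b k (diff (X a) k x) = diff (X b) k (transition X a b (k + 1) x).
Proof.
move: b; apply: leq_ind_from => [|b leab IHb]; first by rewrite !transition_id.
by rewrite !transitionS // IHb cmap_diff.
Qed.

Lemma transition_trans X a b c k x : (a <= b)%N -> (b <= c)%N ->
  transition X b c k (transition X a b k x) = transition X a c k x.
Proof.
move=> leab; move: c; apply: leq_ind_from => [|c lebc IHc].
  by rewrite transition_id.
by rewrite !transitionS ?IHc // (leq_trans leab).
Qed.

Lemma transition_natural X Y (f : d0map X Y) a b k x : (a <= b)%N ->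
  f b k (transition X a b k x) = transition Y a b k (f a k x).
Proof.
move: b; apply: leq_ind_from => [|b leab IHb]; first by rewrite !transition_id.
by rewrite !transitionS // d0m_lambda IHb.
Qed.

(** The relation between alpha and lambda, iterated. *)
Lemma alpha_transition X a b k x : (a <= b)%N ->
  d0_alpha X b k (transition X a.+1 b.+1 k x) =
  tmap S (transition X a b k) (d0_alpha X a k x).
Proof.
move: b; apply: leq_ind_from => [|b leab IHb].
  by rewrite transition_id tmap_id // => y; rewrite transition_id.
rewrite transitionS // d0_compat IHb.
by apply: tmap_comp => y; rewrite transitionS.
Qed.

(** A composite of weak equivalences is one. *)
Lemma weak_equivalence_transition X a b (k : int) :
  (a <= b)%N -> (forall i, (a <= i < b)%N -> weak_equivalence (d0_lambda X i)) ->
  (forall x : X a (k + 1), diff (X a) k x = 0 ->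
     (exists z, diff (X b) (k + 1) z = transition X a b (k + 1) x) ->
     exists y, diff (X a) (k + 1) y = x) /\
  (forall y : X b (k + 1), diff (X b) k y = 0 ->
     exists (x : X a (k + 1)) (z : X b (k + 1 + 1)),
       diff (X a) k x = 0 /\
       y = transition X a b (k + 1) x + diff (X b) (k + 1) z).
Proof.
move: b; apply: leq_ind_from => [|b leab IHb] we.
  split=> [x _ [z]|y dy]; first by rewrite transition_id => <-; exists z.
  by exists y, 0; rewrite transition_id linear0 addr0.
have [|inj_b surj_b] := IHb.
  by move=> i /andP[lai lib]; apply: we; rewrite lai ltnW.
have [|inj_l surj_l] := we b _ k; first by rewrite leab /=.
split=> [x dx [z zE]|y dy].
  apply: inj_b => //; apply: inj_l; last by exists z; rewrite zE transitionS.
  by rewrite -transition_diff // dx linear0.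
have [y' [z [dy' ->]]] := surj_l y dy; have [x [z' [dx ->]]] := surj_b y' dy'.
exists x, (d0_lambda X b (k + 1 + 1) z' + z); split=> //.
by rewrite transitionS // linearD linearD addrA cmap_diff.
Qed.

(** Injectivity with projective cokernel of the maps lambda passes to their
    composites, in each degree. *)
Lemma transition_retraction X a b k : (a <= b)%N ->
  (forall i, cofibration (d0_lambda X i)) ->
  exists r : {linear X b k -> X a k}, forall x, r (transition X a b k x) = x.
Proof.
move=> + cof; move: b; apply: leq_ind_from => [|b leab [r rE]].
  by exists idfun => x; rewrite transition_id.
have [Q [g [projQ ex]]] := cof b.
have [s [r' [_ r'E _]]] := exact_split (ex k) (projQ k).
by exists (r \o r') => x; rewrite transitionS //= r'E rE.
Qed.

End Transition.

Arguments transition : simpl never.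

(** * Pushouts along split monomorphisms *)

(** A pushout of [f] and [l] whose two maps into it are jointly surjective, with
    kernel the image of [A], and which is projective if [B] and [C] are. *)
Record pushout (R : pzRingType) (A B C : rmodType R)
    (f : {linear A -> C}) (l : {linear A -> B}) := Pushout {
  po_obj :> rmodType R;
  po_inl : {linear C -> po_obj};
  po_inr : {linear B -> po_obj};
  po_glue : forall a, po_inl (f a) = po_inr (l a);
  po_decomp : forall p, exists c b, p = po_inl c + po_inr b;
  po_eq0 : forall c b, po_inl c + po_inr b = 0 -> exists a, c = f a /\ b = - l a;
  po_rec : forall (N : rmodType R) (u : {linear C -> N}) (v : {linear B -> N}),
    (forall a, u (f a) = v (l a)) -> {linear po_obj -> N};
  po_rec_inl : forall (N : rmodType R) (u : {linear C -> N}) (v : {linear B -> N})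
      (uv : forall a, u (f a) = v (l a)) c,
    @po_rec N u v uv (po_inl c) = u c;
  po_rec_inr : forall (N : rmodType R) (u : {linear C -> N}) (v : {linear B -> N})
      (uv : forall a, u (f a) = v (l a)) b,
    @po_rec N u v uv (po_inr b) = v b;
  po_projective : projective B -> projective C -> projective po_obj }.

Section Pushout.
Variables (R : pzRingType) (A B C : rmodType R).
Variables (f : {linear A -> C}) (l : {linear A -> B}) (r : {linear B -> A}).
Hypothesis rl : forall x, r (l x) = x.

(** The pushout along the split monomorphism [l], with retraction [r]: the sum of
    [C] and of the complement [ker r] of the image of [l]. *)
Definition split_pushout_obj : rmodType R := (C * submod_type (kernel r))%type.

Lemma split_pushout_complement_subproof x :
  in_submodule (kernel r) ((idfun \- (l \o r) : {linear B -> B}) x).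
Proof. by rewrite /= linearB /= rl subrr. Qed.

Definition split_pushout_complement : {linear B -> submod_type (kernel r)} :=
  projT1 (cid (corestriction split_pushout_complement_subproof)).

Lemma split_pushout_complementE x :
  submod_incl (kernel r) (split_pushout_complement x) = x - l (r x).
Proof. by rewrite /split_pushout_complement; case: cid. Qed.

Lemma split_pushout_inl_subproof : linear (fun c => (c, 0) : split_pushout_obj).
Proof.
move=> a x y; rewrite [RHS]surjective_pairing; congr pair.
by rewrite /= scaler0 addr0.
Qed.

Definition split_pushout_inl : {linear C -> split_pushout_obj} :=
  mklin split_pushout_inl_subproof.

Lemma split_pushout_inr_subproof :
  linear (fun b => (f (r b), split_pushout_complement b) : split_pushout_obj).
Proof. by move=> a x y; rewrite !linearP. Qed.

Definition split_pushout_inr : {linear B -> split_pushout_obj} :=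
  mklin split_pushout_inr_subproof.

Lemma split_pushout_glue a : split_pushout_inl (f a) = split_pushout_inr (l a).
Proof.
rewrite /= rl; congr pair; apply: submod_incl_inj.
by rewrite split_pushout_complementE rl subrr linear0.
Qed.

Lemma split_pushout_decomp (p : split_pushout_obj) :
  p = split_pushout_inl p.1 + split_pushout_inr (submod_incl _ p.2).
Proof.
have r0 : r (submod_incl _ p.2) = 0 := submod_inclP p.2.
rewrite [LHS]surjective_pairing [RHS]surjective_pairing /=.
congr pair; first by rewrite r0 linear0 addr0.
apply: submod_incl_inj.
by rewrite add0r split_pushout_complementE r0 linear0 subr0.
Qed.

Lemma split_pushout_eq0 c b : split_pushout_inl c + split_pushout_inr b = 0 ->
  exists a, c = f a /\ b = - l a.
Proof.
move=> e; have e1 := congr1 fst e; have := congr1 snd e.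
rewrite /= add0r => e2.
exists (- r b); split.
  by rewrite linearN; apply/eqP; rewrite -addr_eq0; apply/eqP; exact: e1.
have := split_pushout_complementE b; rewrite e2 linear0 => /esym/eqP.
by rewrite subr_eq0 linearN opprK => /eqP.
Qed.

Section Recursor.
Variables (N : rmodType R) (u : {linear C -> N}) (v : {linear B -> N}).

Lemma split_pushout_rec_subproof :
  linear (fun p : split_pushout_obj => u p.1 + v (submod_incl _ p.2)).
Proof.
move=> a x y.
by rewrite [(_ + _).1]/= [(_ + _).2]/= !linearP scalerDr addrACA.
Qed.

Definition split_pushout_rec : {linear split_pushout_obj -> N} :=
  mklin split_pushout_rec_subproof.

Lemma split_pushout_recE p : split_pushout_rec p = u p.1 + v (submod_incl _ p.2).
Proof. by []. Qed.

Hypothesis uv : forall a, u (f a) = v (l a).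

Lemma split_pushout_rec_inl c : split_pushout_rec (split_pushout_inl c) = u c.
Proof. by rewrite -[LHS]/(u c + v (submod_incl _ 0)) !linear0 addr0. Qed.

Lemma split_pushout_rec_inr b : split_pushout_rec (split_pushout_inr b) = v b.
Proof.
rewrite -[LHS]/(u (f (r b)) + v (submod_incl _ (split_pushout_complement b))).
by rewrite split_pushout_complementE linearB uv addrC subrK.
Qed.

End Recursor.

Lemma split_pushout_projective :
  projective B -> projective C -> projective split_pushout_obj.
Proof.
move=> projB projC M N p h surjp.
have [gB gBE] := projB _ _ p (h \o split_pushout_inr) surjp.
have [gC gCE] := projC _ _ p (h \o split_pushout_inl) surjp.
exists (split_pushout_rec gC gB) => x.
rewrite split_pushout_recE linearD gBE gCE.
by rewrite [in RHS](split_pushout_decomp x) [RHS]linearD.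
Qed.

Lemma split_pushout : pushout f l.
Proof.
apply: (@Pushout _ _ _ _ f l split_pushout_obj split_pushout_inl
  split_pushout_inr split_pushout_glue _ split_pushout_eq0
  (fun N u v _ => split_pushout_rec u v)).
- by move=> p; do 2 eexists; exact: split_pushout_decomp.
- by move=> N u v _ c; exact: split_pushout_rec_inl.
- by move=> N u v uv b; exact: split_pushout_rec_inr.
- exact: split_pushout_projective.
Qed.

End Pushout.

(** * Factorization through an acyclic D0-complex *)

Lemma add_sub_cross (V : zmodType) (x y a b : V) :
  (x - a + b) + (y + a - b) = x + y.
Proof. by rewrite addrACA subrr addr0 addrACA addNr addr0. Qed.

(** The D0-complex of the pushouts [E i k] of the maps from [Y (minn i n)] to
    [X (minn i n)] and to [Y i]. Its structure maps are defined on the images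
    [inX] and [inY] of the two factors. *)
Section AcyclicPushout.
Variables (R : pzRingType) (S : bimodule R) (Y X : d0complex S).
Variables (f : d0map Y X) (n : nat).

Notation m i := (minn i n).
Notation t i k := (transition Y (minn i n) i k).

Variable E : forall i k, pushout (f (m i) k) (t i k).
Arguments E : clear implicits.

Let le_m i : (m i <= i)%N. Proof. exact: geq_minl. Qed.
Let le_mS i : (m i <= m i.+1)%N. Proof. lia. Qed.
Let le_mSS i : (m i.+1 <= (m i).+1)%N. Proof. lia. Qed.

Let inX i k := po_inl (E i k).
Let inY i k := po_inr (E i k).
Arguments inX : clear implicits.
Arguments inY : clear implicits.

Let E_ext i k (N : rmodType R) (g h : {linear E i k -> N}) x :
  (forall c, g (inX i k c) = h (inX i k c)) ->
  (forall b, g (inY i k b) = h (inY i k b)) -> g x = h x.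
Proof.
by have [c [b ->]] := po_decomp x => gl gr; rewrite !linearD gl gr.
Qed.

Let diff_glue i k a :
  (inX i k \o diff (X (m i)) k) (f (m i) (k + 1) a) =
  (inY i k \o diff (Y i) k) (t i (k + 1) a).
Proof. by rewrite /= -cmap_diff -transition_diff //; exact: po_glue. Qed.

Let E_diff i k : {linear E i (k + 1) -> E i k} :=
  po_rec (E i (k + 1)) (@diff_glue i k).

Let E_diff_inX i k c : E_diff i k (inX i (k + 1) c) = inX i k (diff _ k c).
Proof. exact: (po_rec_inl (E i (k + 1)) (@diff_glue i k)). Qed.

Let E_diff_inY i k b : E_diff i k (inY i (k + 1) b) = inY i k (diff _ k b).
Proof. exact: (po_rec_inr (E i (k + 1)) (@diff_glue i k)). Qed.

Let E_diff_diff i k x : E_diff i k (E_diff i (k + 1) x) = 0.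
Proof.
have [c [b ->]] := po_decomp x.
rewrite [E_diff i (k + 1) _]linearD [LHS]linearD !E_diff_inX !E_diff_inY.
by rewrite !diff_diff !linear0 addr0.
Qed.

Let E_cx i : complex R :=
  @Complex R (fun k => E i k) (E_diff i) (@E_diff_diff i).

Let lambda_glue i k a :
  (inX i.+1 k \o transition X (m i) (m i.+1) k) (f (m i) k a) =
  (inY i.+1 k \o d0_lambda Y i k) (t i k a).
Proof.
rewrite /= -transition_natural // -transitionS //.
rewrite -(transition_trans a (le_mS i) (le_m i.+1)); exact: po_glue.
Qed.

Let E_lambda i k : {linear E i k -> E i.+1 k} :=
  po_rec (E i k) (@lambda_glue i k).

Let E_lambda_inX i k c :
  E_lambda i k (inX i k c) = inX i.+1 k (transition X (m i) (m i.+1) k c).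
Proof. exact: (po_rec_inl (E i k) (@lambda_glue i k)). Qed.

Let E_lambda_inY i k b :
  E_lambda i k (inY i k b) = inY i.+1 k (d0_lambda Y i k b).
Proof. exact: (po_rec_inr (E i k) (@lambda_glue i k)). Qed.

Let E_lambda_diff i k x :
  E_lambda i k (diff (E_cx i) k x) = diff (E_cx i.+1) k (E_lambda i (k + 1) x).
Proof.
apply: (@E_ext i (k + 1) _ (E_lambda i k \o E_diff i k)
  (E_diff i.+1 k \o E_lambda i (k + 1))) => y /=.
  by rewrite E_diff_inX !E_lambda_inX E_diff_inX transition_diff.
by rewrite E_diff_inY !E_lambda_inY E_diff_inY cmap_diff.
Qed.

Let alpha_glue i k a :
  (tmap S (inX i k) \o d0_alpha X (m i) k \o transition X (m i.+1) (m i).+1 k)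
    (f (m i.+1) k a) =
  (tmap S (inY i k) \o d0_alpha Y i k) (t i.+1 k a).
Proof.
rewrite /= -transition_natural // -d0m_alpha.
rewrite -(transition_trans (c := i.+1) a (le_mSS i)) ?ltnS //.
rewrite (alpha_transition _ (le_m i)).
apply: (tmap_commute (f := f (m i) k) (g := inX i k) (f' := t i k)
  (g' := inY i k)) => y.
exact: po_glue.
Qed.

Let E_alpha i k : {linear E i.+1 k -> tensor S (E i k)} :=
  po_rec (E i.+1 k) (@alpha_glue i k).

Let E_alpha_inX i k c : E_alpha i k (inX i.+1 k c) =
  tmap S (inX i k) (d0_alpha X (m i) k (transition X (m i.+1) (m i).+1 k c)).
Proof. exact: (po_rec_inl (E i.+1 k) (@alpha_glue i k)). Qed.

Let E_alpha_inY i k b :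
  E_alpha i k (inY i.+1 k b) = tmap S (inY i k) (d0_alpha Y i k b).
Proof. exact: (po_rec_inr (E i.+1 k) (@alpha_glue i k)). Qed.

Let E_alpha_diff i k x : E_alpha i k (diff (E_cx i.+1) k x) =
  diff (tensor_complex S (E_cx i)) k (E_alpha i (k + 1) x).
Proof.
apply: (@E_ext i.+1 (k + 1) _ (E_alpha i k \o E_diff i.+1 k)
  (tmap S (E_diff i k) \o E_alpha i (k + 1))) => y /=.
  rewrite E_diff_inX !E_alpha_inX transition_diff // cmap_diff /=.
  by apply: tmap_commute => z; rewrite E_diff_inX.
rewrite E_diff_inY !E_alpha_inY cmap_diff /=.
by apply: tmap_commute => z; rewrite E_diff_inY.
Qed.

Let E_compat i k (x : E i.+1 k) :
  E_alpha i.+1 k (E_lambda i.+1 k x) = tmap S (E_lambda i k) (E_alpha i k x).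
Proof.
apply: (@E_ext i.+1 k _ (E_alpha i.+1 k \o E_lambda i.+1 k)
  (tmap S (E_lambda i k) \o E_alpha i k)) => y /=.
  rewrite E_lambda_inX !E_alpha_inX transition_trans //.
  rewrite (tmap_commute (f := inX i k) (g := E_lambda i k)
    (f' := transition X (m i) (m i.+1) k) (g' := inX i.+1 k)).
    by rewrite -alpha_transition // transition_trans ?ltnS.
  by move=> z; rewrite E_lambda_inX.
rewrite E_lambda_inY !E_alpha_inY d0_compat.
by apply: tmap_commute => z; rewrite E_lambda_inY.
Qed.

Let E_proj i : projective_complex (E_cx i).
Proof. by move=> k; apply: po_projective; exact: d0_proj. Qed.

Let E_lambda_map i :=
  @ChainMap R (E_cx i) (E_cx i.+1) (E_lambda i) (@E_lambda_diff i).
Let E_alpha_map i :=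
  @ChainMap R (E_cx i.+1) (tensor_complex S (E_cx i)) (E_alpha i)
    (@E_alpha_diff i).

Let E_d0 : d0complex S :=
  @D0Complex R S E_cx E_proj E_lambda_map E_alpha_map E_compat.

Let to_E_diff i k x :
  inY i k (diff (Y i) k x) = diff (E_d0 i) k (inY i (k + 1) x).
Proof. by rewrite [RHS]E_diff_inY. Qed.

Let to_E : d0map Y E_d0.
Proof.
apply: (@D0Map _ _ Y E_d0 (fun i =>
  @ChainMap R (Y i) (E_d0 i) (inY i) (@to_E_diff i))) => i k x /=.
  by rewrite E_lambda_inY.
by rewrite E_alpha_inY.
Defined.

Let from_glue i k a :
  transition X (m i) i k (f (m i) k a) = f i k (t i k a).
Proof. by rewrite transition_natural. Qed.

Let from i k : {linear E i k -> X i k} := po_rec (E i k) (@from_glue i k).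

Let from_inX i k c : from i k (inX i k c) = transition X (m i) i k c.
Proof. exact: (po_rec_inl (E i k) (@from_glue i k)). Qed.

Let from_inY i k b : from i k (inY i k b) = f i k b.
Proof. exact: (po_rec_inr (E i k) (@from_glue i k)). Qed.

Let from_diff i k x :
  from i k (diff (E_d0 i) k x) = diff (X i) k (from i (k + 1) x).
Proof.
apply: (@E_ext i (k + 1) _ (from i k \o E_diff i k)
  (diff (X i) k \o from i (k + 1))) => y /=.
  by rewrite E_diff_inX !from_inX transition_diff.
by rewrite E_diff_inY !from_inY cmap_diff.
Qed.

Let from_lambda i k (x : E i k) :
  from i.+1 k (E_lambda i k x) = d0_lambda X i k (from i k x).
Proof.
apply: (@E_ext i k _ (from i.+1 k \o E_lambda i k)
  (d0_lambda X i k \o from i k)) => y /=.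
  rewrite E_lambda_inX !from_inX transition_trans //.
  by rewrite transitionS.
by rewrite E_lambda_inY !from_inY d0m_lambda.
Qed.

Let from_alpha i k (x : E i.+1 k) :
  tmap S (from i k) (E_alpha i k x) = d0_alpha X i k (from i.+1 k x).
Proof.
apply: (@E_ext i.+1 k _ (tmap S (from i k) \o E_alpha i k)
  (d0_alpha X i k \o from i.+1 k)) => y /=.
  rewrite E_alpha_inX from_inX (tmap_comp (h := transition X (m i) i k)).
    by rewrite -alpha_transition // transition_trans ?ltnS.
  by move=> z; rewrite from_inX.
by rewrite E_alpha_inY from_inY (tmap_comp (h := f i k)) ?d0m_alpha.
Qed.

Let from_E : d0map E_d0 X.
Proof.
exact: (@D0Map _ _ E_d0 X
  (fun i => @ChainMap R (E_d0 i) (X i) (from i) (@from_diff i))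
  from_lambda from_alpha).
Defined.

Hypothesis t_inj : forall i k, injective (t i k).
Hypothesis weY : forall i, (n <= i)%N -> weak_equivalence (d0_lambda Y i).
Hypothesis acX : forall i, (i <= n)%N -> acyclic (X i).

Let E_acyclic : d0_acyclic E_d0.
Proof.
move=> i; elim/int_succ_ind => k e.
have [x [y ->]] := po_decomp e; rewrite -/(inX _ _) -/(inY _ _) => de.
have : inX i (k + 1) (diff _ (k + 1) x) + inY i (k + 1) (diff _ (k + 1) y) = 0.
  by rewrite -E_diff_inX -E_diff_inY -linearD.
move=> /po_eq0[a [dx dy]].
have we : forall j, (m i <= j < i)%N -> weak_equivalence (d0_lambda Y j).
  by move=> j lij; apply: weY; lia.
have [inj_k _] := weak_equivalence_transition k (le_m i) we.
have [_ surj_k1] := weak_equivalence_transition (k + 1) (le_m i) we.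
(* If x + y is a cycle, then d x = f a and d y = - t a for a cycle a of Y (m i),
   which is a boundary d a' since t is injective in homology. Then x - f a' is a
   cycle, and so is y + t a', which is homologous to some t b; finally f b is a
   boundary. *)
have da : diff _ k a = 0.
  apply: (t_inj (i := i)); rewrite transition_diff //.
  by rewrite -[t _ _ a]opprK -dy linearN diff_diff oppr0 linear0.
have [|a' a'E] := inj_k a da.
  by exists (- y); rewrite linearN dy opprK.
have acXm : acyclic (X (m i)) by apply: acX; exact: geq_minr.
have [|x' x'E] := acXm _ (x - f (m i) _ a').
  by rewrite linearB dx -cmap_diff a'E subrr.
have [|b [z [db yE]]] := surj_k1 (y + t i _ a').
  by rewrite linearD dy -transition_diff // a'E addNr.
have [|x'' x''E] := acXm _ (f (m i) _ b).
  by rewrite -cmap_diff db linear0.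
exists (inX i _ (x' + x'') + inY i _ z).
transitivity (inX i _ (diff _ _ (x' + x'')) + inY i _ (diff _ _ z)).
  by rewrite [LHS]linearD -E_diff_inX -E_diff_inY.
have -> : diff (Y i) (k + 1 + 1) z = y + t i (k + 1 + 1) a' - t i (k + 1 + 1) b.
  by rewrite yE [RHS]addrAC subrr add0r.
rewrite (linearD (diff _ _)) x'E x''E (linearD (inX _ _)) !(linearB (inX _ _)).
rewrite (linearB (inY _ _)) (linearD (inY _ _)) /inX /inY !po_glue.
exact: add_sub_cross.
Qed.

(** The pushouts [E i k] are the terms of a D0-complex factorizing [f]. *)
Lemma pushout_factorization : exists (Z : d0complex S) (g : d0map Y Z)
    (h : d0map Z X),
  d0_acyclic Z /\ forall i (k : int) x, h i k (g i k x) = f i k x.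
Proof.
exists E_d0, to_E, from_E; split; first exact: E_acyclic.
by move=> i k x; exact: from_inY.
Qed.

End AcyclicPushout.

Lemma local_of_acyclic (R : pzRingType) (S : bimodule R) (n : nat)
    (X : d0complex S) :
  (forall i, (i <= n)%N -> acyclic (X i)) -> local (@B_class R S n) X.
Proof.
move=> acX Y f [_ _ cofY weY].
have ret i k := transition_retraction k (geq_minl i n) cofY.
have po i k : pushout (f (minn i n) k) (transition Y (minn i n) i k).
  by have [r rE] := cid (ret i k); exact: split_pushout rE.
apply: (pushout_factorization po) => // i k.
by have [r rE] := ret i k; exact: can_inj rE.
Qed.

(** * Test objects *)

Section TestObjects.
Variable R : pzRingType.

Lemma pin_subproof (b : bool) (a : R^c) (x y : (R^c)^o) :
  (~~ b -> x = 0) -> (~~ b -> y = 0) -> ~~ b -> a *: x + y = 0.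
Proof. by move=> x0 y0 nb; rewrite x0 ?y0 // scaler0 addr0. Qed.

Definition pin_submodule (b : bool) : submodule (R^c)^o :=
  Submodule (fun _ => erefl) (@pin_subproof b).

(** The module [R] if [b] is true and 0 otherwise, as a submodule of [R]. *)
Definition pin (b : bool) : rmodType R :=
  submod_type (pin_submodule b).

(** The inclusion in [R]. *)
Definition pin_val b : {linear pin b -> (R^c)^o} := submod_incl _.

Lemma pin_val_inj b : injective (@pin_val b).
Proof. exact: submod_incl_inj. Qed.

Lemma pin_val0 b (x : pin b) : ~~ b -> pin_val b x = 0.
Proof. by move=> nb; exact: (submod_inclP x nb). Qed.

Lemma pin_eq0 b (x : pin b) : ~~ b -> x = 0.
Proof. by move=> nb; apply: pin_val_inj; rewrite pin_val0 // linear0. Qed.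

Lemma pin_one_exists b : exists e : pin b, pin_val b e = if b then 1 else 0.
Proof.
pose V := (R^c)^o; pose f : {linear V -> V} :=
  if b then (idfun : {linear V -> V}) else (\0 : {linear V -> V}).
have [|g gE] := corestriction (U := pin_submodule b) (f := f).
  by rewrite /f; case: (b).
by exists (g 1); rewrite [LHS]gE /f; case: (b).
Qed.

(** The generator of [pin b], which is 0 when [b] is false. *)
Definition pin_one b : pin b := projT1 (cid (pin_one_exists b)).

Lemma pin_val_one b : pin_val b (pin_one b) = if b then 1 else 0.
Proof. by rewrite /pin_one; case: cid. Qed.

Lemma pin_gen b (x : pin b) : x = (pin_val b x : R^c) *: pin_one b.
Proof.
apply: pin_val_inj; rewrite linearZ_LR pin_val_one.
by case: b x => x; [rewrite [RHS]mulr1 | rewrite pin_val0 // scale0r].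
Qed.

Lemma pin_lift_subproof b (M : rmodType R) (m : M) :
  linear (fun x : pin b => (pin_val b x : R^c) *: m).
Proof. by move=> a x y; rewrite linearP scalerDl scalerA. Qed.

(** The linear map sending the generator to [m] when [b] is true, and 0 when [b]
    is false. *)
Definition pin_lift b (M : rmodType R) (m : M) : {linear pin b -> M} :=
  mklin (pin_lift_subproof (b := b) m).

Lemma pin_liftE b (M : rmodType R) (m : M) (x : pin b) :
  pin_lift b m x = (pin_val b x : R^c) *: m.
Proof. by []. Qed.

Lemma pin_linear b (M : rmodType R) (f : {linear pin b -> M}) x :
  f x = (pin_val b x : R^c) *: f (pin_one b).
Proof. by rewrite -linearZ_LR -pin_gen. Qed.

Lemma pin_projective b : projective (pin b).
Proof.
move=> M N p f surjp; have [m pm] := surjp (f (pin_one b)).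
by exists (pin_lift b m) => x; rewrite pin_liftE linearZ_LR pm -pin_linear.
Qed.

Lemma pin_fin_gen b : fin_gen (pin b).
Proof.
exists 1%N, (fun=> pin_one b) => x; exists (fun=> pin_val b x).
by rewrite big_ord1 -pin_gen.
Qed.

(** The identity of [R] when [b] and [c] are true, and 0 otherwise. *)
Definition pin_map b c : {linear pin b -> pin c} := pin_lift b (pin_one c).

Lemma pin_val_map b c (x : pin b) :
  b ==> c -> pin_val c (pin_map b c x) = pin_val b x.
Proof.
move=> bc; rewrite pin_liftE linearZ_LR pin_val_one.
case: b bc x => bc x; last by rewrite pin_val0 // scale0r.
by rewrite (bc : c) [LHS]mulr1.
Qed.

(** The module [R] in degree [d] if [b] is true, and the zero complex
    otherwise. *)
Definition point (d : int) (b : bool) : complex R :=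
  @Complex R (fun k => pin (b && (k == d))) (fun k => \0) (fun k x => erefl).

Lemma point_projective d b : projective_complex (point d b).
Proof. by move=> k; exact: pin_projective. Qed.

Lemma point_finite d b : finite_complex (point d b).
Proof.
exists (pin b), (fun k => pin_map (b && (k == d)) b).
split; last exact: pin_fin_gen.
have ib k : b && (k == d) ==> b by apply/implyP=> /andP[].
move=> N g; exists (pin_lift b (g d (pin_one _))); split=> [k x|h hE y].
  rewrite pin_liftE pin_val_map //.
  have [/eqP ekd|nkd] := orP (orbN (k == d)).
    by subst k; rewrite -pin_linear.
  have k0 : ~~ (b && (k == d)) by rewrite (negPf nkd) andbF.
  by rewrite pin_val0 // scale0r (pin_eq0 x k0) linear0.
rewrite pin_linear pin_liftE -hE; congr (_ *: h _).
by apply: pin_val_inj; rewrite pin_val_map // !pin_val_one eqxx andbT.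
Qed.

Definition point_map d b c : chain_map (point d b) (point d c).
Proof.
apply: (@ChainMap R (point d b) (point d c)
  (fun k => pin_map (b && (k == d)) (c && (k == d)))).
by move=> k x; rewrite [LHS]linear0.
Defined.

Lemma pin_val_point_map d b c k x : (b && (k == d)) ==> (c && (k == d)) ->
  pin_val (c && (k == d)) (point_map d b c k x) = pin_val (b && (k == d)) x.
Proof. exact: pin_val_map. Qed.

Lemma point_map_cofibration d b c : b ==> c -> cofibration (point_map d b c).
Proof.
move=> bc; exists (point d (c && ~~ b)), (point_map d c (c && ~~ b)).
split=> [|k]; first exact: point_projective.
have bck : b && (k == d) ==> c && (k == d).
  by apply/implyP=> /andP[tb ->]; rewrite (implyP bc).
have cbk : (c && ~~ b) && (k == d) ==> c && (k == d).
  by apply/implyP=> /andP[/andP[-> _] ->].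
split.
- move=> x y /(congr1 (pin_val _)).
  by rewrite !pin_val_point_map // => /pin_val_inj.
- move=> y; split=> [gy|[x <-]].
    exists (pin_map (c && (k == d)) (b && (k == d)) y); apply: pin_val_inj.
    rewrite pin_val_point_map //.
    have [tb|nb] := orP (orbN b).
      by rewrite pin_val_map // tb; apply/implyP=> /andP[].
    rewrite pin_val0 ?(negPf nb) //.
    have := congr1 (pin_val _) gy; rewrite linear0 pin_val_point_map //.
    by rewrite nb andbT implybb.
  apply: pin_val_inj; rewrite linear0.
  have [tb|nb] := orP (orbN b); first by rewrite pin_val0 // tb andbF.
  by rewrite (@pin_eq0 (b && (k == d)) x) ?linear0 // (negPf nb).
- move=> z; exists (pin_map (c && ~~ b && (k == d)) (c && (k == d)) z).
  apply: pin_val_inj.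
  have [tz|nz] := orP (orbN ((c && ~~ b) && (k == d))).
    by rewrite pin_val_point_map ?pin_val_map //; apply/implyP=> _.
  by rewrite !pin_val0.
Qed.

Lemma point_map_weak_equivalence d : weak_equivalence (point_map d true true).
Proof.
move=> k; split=> [x _ [z fx]|y _].
  exists 0; apply: pin_val_inj.
  have := congr1 (pin_val _) fx.
  by rewrite pin_val_point_map ?implybb // !linear0.
exists y, 0; split=> //; rewrite linear0 addr0.
by apply: pin_val_inj; rewrite pin_val_point_map ?implybb.
Qed.

End TestObjects.

Arguments pin_val {R} b.

Section Detection.
Variables (R : pzRingType) (S : bimodule R) (X : d0complex S).

Lemma test_alpha_diff d b c k (x : point R d b (k + 1)) :
  (\0 : {linear point R d b k -> tensor_complex S (point R d c) k})
    (diff _ k x) =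
  diff (tensor_complex S (point R d c)) k
    ((\0 : {linear point R d b (k + 1) ->
                   tensor_complex S (point R d c) (k + 1)}) x).
Proof. by rewrite /= linear0. Qed.

(** The module [R] in degree [d] at the indices [j >= i], and 0 at the others,
    with lambda the identity wherever possible and alpha equal to 0. *)
Definition test_object (d : int) (i : nat) : d0complex S.
Proof.
apply: (@D0Complex R S (fun j => point R d (i <= j)%N) _
  (fun j => point_map R d (i <= j)%N (i <= j.+1)%N)
  (fun j => ChainMap (@test_alpha_diff d (i <= j.+1)%N (i <= j)%N))).
  by move=> j; exact: point_projective.
by move=> j k x; rewrite /= linear0.
Defined.

Lemma test_object_B_class d i n : (0 < i <= n)%N -> B_class n (test_object d i).
Proof.
move=> /andP[i_gt0 lein]; split=> [k x|j|j|j lenj].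
- by apply: pin_eq0; rewrite leqNgt i_gt0.
- by apply: finite_h_finite; [exact: point_projective | exact: point_finite].
- by apply: point_map_cofibration; apply/implyP=> /leqW.
- rewrite /= (leq_trans lein lenj) (leq_trans lein (leqW lenj)).
  exact: point_map_weak_equivalence.
Qed.

Section Map.
Variables (d : int) (i : nat) (z : X i.+1 (d + 1)).
Hypotheses (dz : diff (X i.+1) d z = 0) (az : d0_alpha X i (d + 1) z = 0).

(* The family of elements equal to z in degree d + 1 and to 0 elsewhere. *)
Let zz : forall k : int, X i.+1 k :=
  @dfwith _ (fun k => X i.+1 k) (fun k => 0) (d + 1) z.

Let f j k : {linear point R (d + 1) (i < j)%N k -> X j k} :=
  pin_lift _ (transition X i.+1 j k (zz k)).

Let fE j k x : f j k x = (pin_val _ x : R^c) *: transition X i.+1 j k (zz k).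
Proof. by []. Qed.

Let zz_diff k : diff (X i.+1) k (zz (k + 1)) = 0.
Proof.
have [/addIr ekd|nkd] := eqVneq (k + 1) (d + 1).
  by rewrite ekd /zz dfwith_in.
by rewrite /zz dfwith_out ?linear0 // eq_sym.
Qed.

Let zz_alpha k : d0_alpha X i k (zz k) = 0.
Proof.
have [ekd|nkd] := eqVneq k (d + 1); first by rewrite ekd /zz dfwith_in.
by rewrite /zz dfwith_out ?linear0 // eq_sym.
Qed.

Let f_diff j k x :
  f j k (diff (point R _ _) k x) = diff (X j) k (f j (k + 1) x).
Proof.
rewrite [LHS]linear0 fE linearZ_LR; have [lij|nij] := orP (orbN (i < j)%N).
  by rewrite -transition_diff // zz_diff linear0 scaler0.
by rewrite pin_val0 ?scale0r // (negPf nij).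
Qed.

(** A cycle [z] killed by alpha is hit by a morphism from a test object: at the
    index [j > i] the generator goes to the image of [z] under the transition
    map. *)
Lemma test_map_exists : exists f : d0map (test_object (d + 1) i.+1) X,
  exists x, f i.+1 (d + 1) x = z.
Proof.
pose f_map j := @ChainMap R (point R (d + 1) (i < j)%N) (X j) (f j) (@f_diff j).
have f_lambda j k x : f_map j.+1 k (d0_lambda (test_object (d + 1) i.+1) j k x)
    = d0_lambda X j k (f_map j k x).
  have vl : pin_val ((i < j.+1)%N && (k == d + 1))
      (d0_lambda (test_object (d + 1) i.+1) j k x) = pin_val _ x.
    by apply: pin_val_point_map; apply/implyP => /andP[/leqW-> ->].
  transitivity ((pin_val _ x : R^c) *: transition X i.+1 j.+1 k (zz k)).
    by congr (_ *: _); exact: vl.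
  rewrite [f_map j k x]fE linearZ_LR.
  have [lij|nij] := orP (orbN (i < j)%N); first by rewrite transitionS.
  by rewrite pin_val0 ?scale0r // (negPf nij).
have f_alpha j k x :
    tmap S (f_map j k) (d0_alpha (test_object (d + 1) i.+1) j k x)
    = d0_alpha X j k (f_map j.+1 k x).
  rewrite [LHS]linear0 [f_map _ _ x]fE linearZ_LR.
  have [lij|nij] := orP (orbN (i < j.+1)%N).
    by rewrite alpha_transition // zz_alpha linear0 scaler0.
  by rewrite pin_val0 ?scale0r // (negPf nij).
exists (D0Map f_lambda f_alpha), (pin_one R _).
rewrite [LHS]fE pin_val_one ltnSn eqxx scale1r transition_id.
by rewrite /zz dfwith_in.
Qed.

End Map.

(** Locality kills the cycles of the kernel of alpha; when the previous complex
    is contractible, surjectivity of alpha makes every cycle homologous to one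
    of these. *)
Lemma local_acyclic n i : reduced X -> local (@B_class R S n) X ->
  (i < n)%N -> contractible (X i) -> acyclic (X i.+1).
Proof.
move=> redX locX ltin cX k x dx.
have := contractible_acyclic (tensor_contractible S cX).
move=> /(_ k (d0_alpha X i (k + 1) x))[|w dw].
  by rewrite -cmap_diff dx linear0.
have [y ay] := redX i (k + 1 + 1) w.
pose z := x - diff (X i.+1) (k + 1) y.
have dz : diff (X i.+1) k z = 0 by rewrite linearB dx diff_diff subr0.
have az : d0_alpha X i (k + 1) z = 0.
  by rewrite linearB cmap_diff ay dw subrr.
have [f [e fe]] := test_map_exists dz az.
have [|E [g [h [acE hg]]]] := locX _ f.
  by apply: test_object_B_class; rewrite ltin.
have [|u du] := acE i.+1 k (g i.+1 (k + 1) e).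
  by rewrite -cmap_diff [diff _ _ _](_ : _ = 0) // linear0.
exists (h i.+1 (k + 1 + 1) u + y).
by rewrite linearD -cmap_diff du hg fe /z subrK.
Qed.

End Detection.

Theorem proposition3 (R : pzRingType) (S : bimodule R)
  (regR : vogel_regular R) (flatS : left_flat S)
  (n : nat) (C : d0complex S)
  (redC : reduced C) (BC : completion (@B_union R S) C) :
  local (@B_class R S n) C <-> forall i : nat, (i <= n)%N -> contractible (C i).
Proof.
split=> [locC|cC]; last first.
  by apply: local_of_acyclic => i lein; apply/contractible_acyclic/cC.
elim=> [_|i IHi ltin]; apply: completion_acyclic_contractible => //.
  exact: completion_acyclic0.
by apply: (local_acyclic redC locC ltin); apply/IHi/ltnW.
Qed.
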